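(* Let $\mu$ be a Borel probability measure on $\mathbb{R}$ and let $\epsilon>0$. If $\mu_{\sf A}\ne 0$ and $(x_n)_{n\in\mathbb{N}}$ (with $x_n\in\Xi_n$ for every $n$) is asymptotically $d_\epsilon$-minimal for $\mu$, then for every interval $I\subset\mathbb{R}$, $$\lim_{n\to\infty}\frac{\#\{1\le j\le n : x_{n,j}\in I\}}{n}=\mu_\epsilon^{\ast}(I).$$
   Context: $\mathbb{R}^+$ denotes the positive reals, and $\lambda$ is Lebesgue measure on $\mathbb{R}$. For a Borel probability measure $\mu$ on $\mathbb{R}$ let $F_\mu(x)=\mu((-\infty,x])$ and $F_{\mu-}(x)=\mu((-\infty,x))$. For $\epsilon>0$ the $\epsilon$-Lévy metric is $$d_\epsilon(\mu,\nu)=\inf\{y\in\mathbb{R}^+ : F_{\mu-}(x-y/\epsilon)-y\le F_\nu(x)\le F_\mu(x+y/\epsilon)+y \text{ for all } x\in\mathbb{R}\}.$$ For $n\in\mathbb{N}=\{1,2,\ldots\}$ let $\Xi_n=\{x\in\mathbb{R}^n: x_{,1}\le\ldots\le x_{,n}\}$, $\Pi_n=\{p\in\mathbb{R}^n:p_{,j}\ge0,\ \sum_{j=1}^np_{,j}=1\}$, and $\delta_x^p=\sum_{j=1}^np_{,j}\delta_{x_{,j}}$ for $x\in\Xi_n$, $p\in\Pi_n$, where $\delta_a$ is the unit point mass at $a$. For $x_n\in\Xi_n$, $x_{n,j}$ denotes its $j$-th coordinate. For given $x\in\Xi_n$, $\delta_x^\bullet$ denotes any best $d_\epsilon$-approximation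 of $\mu$ given $x$, so that $d_\epsilon(\mu,\delta_x^\bullet)=\min_{p\in\Pi_n}d_\epsilon(\mu,\delta_x^p)$; and $\delta_\bullet^{\bullet,n}$ denotes any best $d_\epsilon$-approximation of $\mu$, so that $d_\epsilon(\mu,\delta_\bullet^{\bullet,n})=\min_{x\in\Xi_n,\,p\in\Pi_n}d_\epsilon(\mu,\delta_x^p)$ (all these minima are attained). For $\mu$ with infinite support (which is the case whenever $\mu_{\sf A}\neq0$), a sequence $(x_n)$ with $x_n\in\Xi_n$ for every $n\in\mathbb{N}$ is called asymptotically $d_\epsilon$-minimal for $\mu$ if $$\lim_{n\to\infty}\frac{d_\epsilon(\mu,\delta_{x_n}^\bullet)}{d_\epsilon(\mu,\delta_\bullet^{\bullet,n})}=1.$$ $\mu=\mu_{\sf A}+\mu_{\sf S}$ is the Lebesgue decomposition of $\mu$, with $\mu_{\sf A}$ absolutely continuous and $\mu_{\sf S}$ singular with respect to $\lambda$. With $\Omega:\mathbb{R}\to\mathbb{R}$, $\Omega(x)=\dfrac{x}{2+2|x|}$, and $\mu_{\sf A}\ne0$, the Borel probability measure $\mu_\epsilon^\ast$ is absolutely continuous with density $$\frac{\mathrm{d}\mu_\epsilon^\ast}{\mathrm{d}\lambda}=\frac{\Omega\!\left(\frac1\epsilon\cdot\frac{\mathrm{d}\mu_{\sf A}}{\mathrm{d}\lambda}\right)}{\int_{\mathbb{R}}\Omega\!\left(\frac1\epsilon\cdot\frac{\mathrm{d}\mu_{\sf A}}{\mathrm{d}\lambda}\right)\mathrm{d}\lambda}.$$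 *)

(* Defs.v *)
From HB Require Import structures.
From mathcomp Require Import all_boot all_order all_algebra.
From mathcomp Require Import all_classical all_reals all_analysis.

Set Implicit Arguments.
Unset Strict Implicit.
Unset Printing Implicit Defensive.

Import Order.TTheory GRing.Theory Num.Theory.
Import numFieldNormedType.Exports.

Local Open Scope classical_set_scope.
Local Open Scope ring_scope.
Local Open Scope charge_scope.

(* The functions below only need the values of a measure on sets, so they are
   stated for set functions; they are meant for Borel probability measures,
   for which [fine] is harmless. *)
Definition Fdist (R : realType) (mu : set R -> \bar R) (x : R) : R :=
  fine (mu `]-oo, x]%classic).

Definition Fdist_left (R : realType) (mu : set R -> \bar R) (x : R) : R :=
  fine (mu `]-oo, x[%classic).

Definition levy_dist (R : realType) (eps : R) (mu nu : set R -> \bar R) : R :=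
  inf [set y : R | 0 < y /\
        forall x : R,
          Fdist_left mu (x - y / eps) - y <= Fdist nu x <=
          Fdist mu (x + y / eps) + y].

Definition Xi (R : realType) (n : nat) : set 'rV[R]_n :=
  [set x | forall i j : 'I_n, (i <= j)%N -> x ord0 i <= x ord0 j].

Definition Pi (R : realType) (n : nat) : set 'rV[R]_n :=
  [set p | (forall j : 'I_n, 0 <= p ord0 j) /\ \sum_(j < n) p ord0 j = 1].

Definition delta (R : realType) (n : nat) (x p : 'rV[R]_n) : set R -> \bar R :=
  fun A => (\sum_(j < n) (p ord0 j)%:E * \d_(x ord0 j) A)%E.

(* [delta x p] is a best d_eps-approximation of mu given the locations x. *)
Definition best_approx_given (R : realType) (eps : R) (mu : set R -> \bar R)
    (n : nat) (x p : 'rV[R]_n) : Prop :=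
  @Pi R n p /\
  forall q : 'rV[R]_n, @Pi R n q ->
    levy_dist eps mu (delta x p) <= levy_dist eps mu (delta x q).

(* [delta y q] is a best d_eps-approximation of mu with n atoms. *)
Definition best_approx (R : realType) (eps : R) (mu : set R -> \bar R)
    (n : nat) (y q : 'rV[R]_n) : Prop :=
  [/\ @Xi R n y, @Pi R n q &
      forall y' q' : 'rV[R]_n, @Xi R n y' -> @Pi R n q' ->
        levy_dist eps mu (delta y q) <= levy_dist eps mu (delta y' q')].

(* Best approximations exist for every n >= 1, and their distance to mu does
   not depend on their choice.  The index n = 0 is excluded throughout:
   there is no probability vector of length 0. *)
Definition asymptotically_minimal (R : realType) (eps : R)
    (mu : set R -> \bar R) (x : forall n, 'rV[R]_n) : Prop :=
  exists p y q : forall n, 'rV[R]_n,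
    [/\ forall n, (0 < n)%N -> best_approx_given eps mu (x n) (p n),
        forall n, (0 < n)%N -> best_approx eps mu (y n) (q n) &
        levy_dist eps mu (delta (x n) (p n)) /
        levy_dist eps mu (delta (y n) (q n)) @[n --> \oo] --> (1 : R)].

Definition mutually_singular d (T : measurableType d) (R : realType)
    (mu nu : set T -> \bar R) : Prop :=
  exists N : set T, [/\ measurable N, mu (~` N) = 0%E & nu N = 0%E].

Definition lebesgue_decomposition (R : realType)
    (mu muA muS : set (measurableTypeR R) -> \bar R) : Prop :=
  [/\ forall A, measurable A -> mu A = (muA A + muS A)%E,
      muA `<< lebesgue_measure &
      mutually_singular muS lebesgue_measure].

Definition Omega (R : realType) (x : R) : R := x / (2 + 2 * `|x|).

Definition star_density (R : realType) (eps : R)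
    (muA : {finite_measure set (measurableTypeR R) -> \bar R}) (t : R) : R :=
  let h s := Omega (eps^-1 *
    fine (('d (charge_of_finite_measure muA) '/d lebesgue_measure) s)) in
  h t / \int[lebesgue_measure]_s h s.

Definition mu_star (R : realType) (eps : R)
    (muA : {finite_measure set (measurableTypeR R) -> \bar R})
    (A : set (measurableTypeR R)) : \bar R :=
  (\int[lebesgue_measure]_(t in A) (star_density eps muA t)%:E)%E.

(* Main.v *)
Require Import Defs.
From HB Require Import structures.
From mathcomp Require Import all_boot all_order all_algebra.
From mathcomp Require Import all_classical all_reals all_analysis.
From mathcomp Require Import measurable_realfun.
From mathcomp Require Import lra ring zify.

Set Implicit Arguments.
Unset Strict Implicit.
Unset Printing Implicit Defensive.

Import Order.TTheory GRing.Theory Num.Theory.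
Import numFieldNormedType.Exports.

Local Open Scope classical_set_scope.
Local Open Scope ring_scope.

(** Why the theorem holds.  Put r = y / eps.  A purely atomic measure with
    atoms x_1 <= ... <= x_n lies within Levy distance y of mu, for a suitable
    choice of the weights, exactly when every gap ]x_j + r, x_{j+1} - r[ between
    consecutive atoms has mu-mass at most 2y and the two outer tails have mass
    at most y: between two atoms the distribution function of the approximation
    is a constant, which has to lie within y of both ends of that gap.  So the
    line is covered by n closed blind intervals of length 2r = 2y/eps and by
    gaps of mass at most 2y.  Where mu has constant density c, a gap has length
    at most 2y/c, so consecutive atoms are at most 2y (1/c + 1/eps) = 2y / phi(c)
    apart, where phi(c) = eps c / (eps + c) = 2 eps Omega(c / eps).  Hence an
    interval J needs about (1 / 2y) * int_J phi(f) atoms, f being the density of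
    muA, and this many suffice: the singular part sits on a Lebesgue null set,
    and covering a finite union of intervals of total length delta with blind
    intervals costs only eps * delta / 2y atoms.

    The proof makes both halves precise, up to an error delta / 2y and a
    constant number of atoms that does not depend on y.  The density f is
    approximated in L^1 by a continuous function, and compactness cuts a bounded
    interval into pieces on which f is close to a constant c in L^1
    ([density_approx]); [singular_cuts] cuts the line so that each piece either
    is covered by a short set or carries almost no singular mass.

    Lower bound ([points_needed_interval]): on a piece, each gap satisfies
    phi(c) * length <= 2y + error ([gap_cost]); summing over gaps and pieces
    bounds int_J phi(f) by 2y times the number of atoms in J.

    Upper bound ([good_configuration]): the greedy sequence t_0 < t_1 < ... in
    which a blind interval is placed as soon as the mass collected since the
    preceding one reaches 2y satisfies, step by step, the reverse inequality
    2y <= phi(c) * length + error ([step_cost]), so it stops after about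
    (1 / 2y) * int phi(f) steps ([few_steps_total]).

    With Phi = int phi(f), the upper bound gives that n times the distance of an
    asymptotically minimal sequence has upper limit at most Phi / 2
    ([levy_dist_upper]).  The lower bound then says that every interval J
    eventually contains a proportion of at least int_J phi(f) / Phi - o(1) of
    the atoms ([count_ratio_lower]).  Applied to I and to the two intervals that
    make up its complement, whose proportions add up to 1, these lower bounds
    are sharp, and int_I phi(f) / Phi is mu_star(I). *)

(** * Induction on intervals, and the harmonic mean of eps and a density *)

Section IntervalInduction.
Context {R : realType}.

(** Properties that can be glued at a point need only be proved on the pieces
    cut out by a finite set: this is how the local estimates below, valid
    between the cut points, become estimates on a whole interval. *)
Lemma cut_induction (Q : R -> R -> Prop) (P : seq R) (a b : R) :
  (forall u v w, a <= u -> u < v -> v < w -> w <= b ->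
     Q u v -> Q v w -> Q u w) ->
  (forall u v, a <= u -> u < v -> v <= b ->
     (forall p, p \in P -> ~~ (u < p < v)) -> Q u v) ->
  a < b -> Q a b.
Proof.
move=> Qcat; elim: P => [|p P IHP] Qpiece ab; first exact: Qpiece.
apply: IHP => // u v au uv vb noP.
have [/andP[up pv]|pNuv] := boolP (u < p < v).
  have noPsub s t : u <= s -> t <= v ->
      (forall q, q \in P -> ~~ (s < q < t)).
    move=> us tv q /noP; apply: contra => /andP[sq qt].
    by rewrite (le_lt_trans us sq) (lt_le_trans qt tv).
  apply: (Qcat _ p) => //; apply: Qpiece => //.
  - exact: le_trans (ltW pv) vb.
  - move=> q; rewrite inE => /predU1P[->|]; first by rewrite ltxx andbF.
    by apply: noPsub => //; exact: ltW.
  - exact: le_trans au (ltW up).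
  - move=> q; rewrite inE => /predU1P[->|]; first by rewrite ltxx.
    by apply: noPsub => //; exact: ltW.
apply: Qpiece => // q; rewrite inE => /predU1P[->//|]; exact: noP.
Qed.

(** Compactness of a segment in inductive form: the supremum of the right
    endpoints reached from [a] must be [b]. *)
Lemma cousin_induction (Q : R -> R -> Prop) (a b : R) :
  (forall u v w, u <= v -> v <= w -> Q u v -> Q v w -> Q u w) ->
  (forall x, exists2 r, 0 < r &
     forall u v, x - r < u -> u <= x -> x <= v -> v < x + r -> Q u v) ->
  a <= b -> Q a b.
Proof.
move=> Qcat Qloc ab.
pose S := [set t | a <= t <= b /\ Q a t].
have Sa : S a.
  split; first by rewrite lexx.
  by have [r r0] := Qloc a; apply => //; lra.
have hS : has_sup S.
  by split; [exists a | exists b => t [/andP[]]].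
have as_ : a <= sup S by apply: ub_le_sup => //; case: hS.
have sb : sup S <= b by apply: ge_sup; [exists a | move=> t [/andP[]]].
have [r r0 Qr] := Qloc (sup S).
have [t [/andP[at_ tb] Qat] st] := sup_adherent r0 hS.
have ts : t <= sup S by apply: ub_le_sup; [case: hS | split=> //; apply/andP].
have Qs : Q a (sup S) by apply: (Qcat _ t) => //; apply: Qr => //; lra.
have [->//|sNb] := eqVneq b (sup S).
have sltb : sup S < b by rewrite lt_neqAle eq_sym sNb.
pose w := Order.min b (sup S + r / 2).
have sw : sup S < w by rewrite lt_min sltb; lra.
have wr : w < sup S + r.
  by apply: (le_lt_trans (y := sup S + r / 2)); [rewrite ge_min lexx orbT|lra].
suff : w <= sup S by rewrite leNgt sw.
apply: ub_le_sup; first by case: hS.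
split; first by rewrite ge_min lexx /= andbT; lra.
by apply: (Qcat _ (sup S)) => //; [lra|apply: Qr; lra].
Qed.

End IntervalInduction.

Section HarmonicMean.
Context {R : realType}.
Variable eps : R.

(** For [t >= 0] this is [eps * t / (eps + t)], half the harmonic mean of
    [eps] and [t]. *)
Definition phi (t : R) : R := 2 * eps * Omega (eps^-1 * t).

Lemma phiE (t : R) : 0 < eps -> 0 <= t -> phi t = eps * t / (eps + t).
Proof.
move=> eps_gt0 t0; rewrite /phi /Omega ger0_norm; last first.
  by rewrite mulr_ge0 ?invr_ge0 // ltW.
have -> : eps^-1 * t = t / eps by rewrite mulrC.
have n1 : eps + t != 0 by rewrite lt0r_neq0//; lra.
have n2 : 2 * eps + 2 * t != 0 by rewrite lt0r_neq0//; lra.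
have n3 : eps != 0 by rewrite lt0r_neq0.
by field; apply/and3P; split.
Qed.

Lemma phi_ge0 (t : R) : 0 < eps -> 0 <= t -> 0 <= phi t.
Proof. by move=> eps_gt0 t0; rewrite phiE// divr_ge0 ?mulr_ge0//; lra. Qed.

Lemma phi_le (t : R) : 0 < eps -> 0 <= t -> phi t <= t.
Proof.
move=> eps_gt0 t0; rewrite phiE// ler_pdivrMr; last lra.
by have := mulr_ge0 t0 t0; lra.
Qed.

Lemma phi_lipschitz (s t : R) : 0 < eps -> 0 <= s -> 0 <= t ->
  `|phi s - phi t| <= `|s - t|.
Proof.
move=> eps_gt0 s0 t0; rewrite !phiE//.
have n1 : eps + t != 0 by rewrite lt0r_neq0//; lra.
have n2 : eps + s != 0 by rewrite lt0r_neq0//; lra.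
have -> : eps * s / (eps + s) - eps * t / (eps + t) =
    (eps / (eps + s)) * (eps / (eps + t)) * (s - t).
  by field; apply/andP; split.
rewrite normrM ler_piMl// normrM mulr_ile1//.
- by rewrite ger0_norm ?divr_ge0// ?ler_pdivrMr; lra.
- by rewrite ger0_norm ?divr_ge0// ?ler_pdivrMr; lra.
Qed.

(** An interval of length [L] between two atoms consists of blind zones of
    total length [2y/eps] and of a gap of [c]-mass at most [2y]; since
    [1 / phi c = 1 / c + 1 / eps], the weights [c / (eps + c)] and
    [eps / (eps + c)] of the two contributions add up to 1. *)
Lemma gap_cost (c y L e : R) : 0 < eps -> 0 <= c -> 0 <= y -> 0 <= e ->
  (2 * y / eps < L -> c * (L - 2 * y / eps) <= 2 * y + e) ->
  phi c * L <= 2 * y + e.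
Proof.
move=> eps_gt0 c0 y0 e0 gap.
pose b := 2 * y / eps.
have bE : eps * b = 2 * y by rewrite /b; field; exact: lt0r_neq0.
have b0 : 0 <= b by rewrite /b divr_ge0//; lra.
have ec : 0 < eps + c by lra.
rewrite phiE// mulrAC ler_pdivrMr// -bE.
have [/gap|Lb] := ltP b L.
  rewrite -/b -bE => gapb; nra.
by have := ler_wpM2l (mulr_ge0 (ltW eps_gt0) c0) Lb; nra.
Qed.

(** The reverse of [gap_cost], for a gap of [c]-mass at least [2y] that is
    followed by a blind zone: [2y] is split in the same proportions. *)
Lemma step_cost (c y L e : R) : 0 < eps -> 0 <= c -> 0 <= e ->
  2 * y <= c * L + e -> 2 * y <= phi c * (L + 2 * y / eps) + e.
Proof.
move=> eps_gt0 c0 e0 yL.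
have bE : eps * (2 * y / eps) = 2 * y by field; exact: lt0r_neq0.
move: bE; set b := 2 * y / eps => bE.
have ec : 0 < eps + c by lra.
rewrite -lerBlDr phiE// mulrAC ler_pdivlMr//.
have : 0 <= e * c by exact: mulr_ge0.
by have := ler_wpM2l (ltW eps_gt0) yL; nra.
Qed.

End HarmonicMean.

(** * Finitely additive set functions on half-open intervals *)

Section IntervalContent.
Context {R : realType}.
Implicit Types (nu : R -> R -> R) (u v w : R).

(** Additivity and positivity of a function of two endpoints, [nu u v] being
    the value at the half-open interval `]u, v]`.  All error terms below have
    this form, so that they can be summed over the pieces of a subdivision. *)
Definition interval_content nu : Prop :=
  (forall u v w, u <= v -> v <= w -> nu u w = nu u v + nu v w) /\
  (forall u v, u <= v -> 0 <= nu u v).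

Lemma content_le nu u u' v' v : interval_content nu ->
  u <= u' -> u' <= v' -> v' <= v -> nu u' v' <= nu u v.
Proof.
move=> [nuD nu0] uu uv vv.
rewrite (nuD u u' v)// ?(nuD u' v' v)//; last exact: le_trans vv.
by have := nu0 _ _ uu; have := nu0 _ _ vv; lra.
Qed.

Lemma itvoc_setU u v w : u <= v -> v <= w ->
  `]u, w]%classic = `]u, v]%classic `|` `]v, w]%classic.
Proof. by move=> uv vw; rewrite -itv_bndbnd_setU ?bnd_simp. Qed.

Lemma itvoc_disjoint u v w : `]u, v]%classic `&` `]v, w]%classic = set0.
Proof.
apply/seteqP; split => // t /=; rewrite !in_itv/= => -[/andP[_ tv] /andP[vt _]].
by move: vt; rewrite ltNge tv.
Qed.

Definition mass (m : set (measurableTypeR R) -> \bar R) u v : R :=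
  fine (m `]u, v]%classic).

Lemma fine_measureU (m : {finite_measure set (measurableTypeR R) -> \bar R})
    (A B : set R) : measurable A -> measurable B -> A `&` B = set0 ->
  fine (m (A `|` B)) = fine (m A) + fine (m B).
Proof.
by move=> mA mB AB; rewrite measureU// fineD ?fin_num_measure.
Qed.

Lemma fine_le_measure (m : {finite_measure set (measurableTypeR R) -> \bar R})
    (A B : set R) : measurable A -> measurable B -> A `<=` B ->
  fine (m A) <= fine (m B).
Proof.
move=> mA mB AB; rewrite fine_le ?fin_num_measure//.
by rewrite le_measure ?inE.
Qed.

Lemma mass_content (m : {finite_measure set (measurableTypeR R) -> \bar R}) :
  interval_content (mass m).
Proof.
split=> [u v w uv vw|u v _]; last by rewrite fine_ge0// measure_ge0.
by rewrite /mass (itvoc_setU uv vw) fine_measureU// itvoc_disjoint.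
Qed.

Notation lebesgue := (@lebesgue_measure R).

Definition integral_oc (k : R -> R) u v : R :=
  \int[lebesgue]_(t in `]u, v]) k t.

Definition locally_integrable_oc (k : R -> R) : Prop :=
  forall u v, lebesgue.-integrable `]u, v] (EFin \o k).

Lemma integral_oc_content k : (forall t, 0 <= k t) ->
  locally_integrable_oc k -> interval_content (integral_oc k).
Proof.
move=> k0 kint; split=> [u v w uv vw|u v _]; last exact: Rintegral_ge0.
rewrite /integral_oc (itvoc_setU uv vw) Rintegral_setU//.
  by rewrite -itvoc_setU//; exact: kint.
by apply/disj_setPS; rewrite itvoc_disjoint.
Qed.

Lemma continuous_integrable_oc (k : R -> R) :
  continuous k -> locally_integrable_oc k.
Proof.
move=> kc u v.
suff: lebesgue.-integrable `[u, v]%classic (EFin \o k).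
  apply: integrableS => //.
  exact: subset_itv_oc_cc.
apply: continuous_compact_integrable; first exact: segment_compact.
exact: continuous_subspaceT.
Qed.

Lemma lebesgue_itvoc u v : u <= v -> fine (lebesgue `]u, v]%classic) = v - u.
Proof.
move=> uv; rewrite lebesgue_measure_itv/= lte_fin.
by move: uv; rewrite le_eqVlt => /predU1P[->|->]; rewrite ?ltxx ?subrr.
Qed.

Lemma lebesgue_itvoc_lty u v : (lebesgue `]u, v]%classic < +oo)%E.
Proof. by rewrite lebesgue_measure_itv/=; case: ifP => _; rewrite ltry. Qed.

Lemma integral_oc_cst c u v : u <= v -> integral_oc (fun=> c) u v = c * (v - u).
Proof.
by move=> uv; rewrite /integral_oc Rintegral_cst//; congr (_ * _);
  exact: lebesgue_itvoc.
Qed.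

(** An L^1 error bounds the difference of integrals; stated with a constant
    because the approximation of a density on a piece is a constant. *)
Lemma integral_oc_approx k1 k2 c u v : u <= v ->
  locally_integrable_oc k1 -> locally_integrable_oc k2 ->
  (forall t, u < t <= v -> `|k1 t - c| <= k2 t) ->
  `|integral_oc k1 u v - c * (v - u)| <= integral_oc k2 u v.
Proof.
move=> uv k1i k2i k12.
have ci : locally_integrable_oc (fun=> c).
  by apply: continuous_integrable_oc; exact: cst_continuous.
rewrite -integral_oc_cst// /integral_oc -RintegralB//.
  apply: (le_trans (le_normr_Rintegral _ _)) => //.
    exact: (integrableB _ (k1i u v) (ci u v)).
  apply: le_Rintegral => //.
    exact: (integrable_norm (integrableB _ (k1i u v) (ci u v))).
Qed.

End IntervalContent.

(** * Local approximation of the absolutely continuous part *)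

Section LocalApproximation.
Context {R : realType}.
Notation lebesgue := (@lebesgue_measure R).

(** Uniform continuity on a segment, in the form of a finite subdivision on
    whose pieces the oscillation is small. *)
Lemma continuous_cuts (g : R -> R) (a b eta : R) : continuous g -> 0 < eta ->
  a <= b -> exists P : seq R, forall u v, a <= u -> u < v -> v <= b ->
    (forall p, p \in P -> ~~ (u < p < v)) ->
    exists x, forall t, u <= t <= v -> `|g t - g x| <= eta.
Proof.
move=> gc eta0.
pose Q u v := exists P : seq R, forall u' v', u <= u' -> u' < v' -> v' <= v ->
    (forall p, p \in P -> ~~ (u' < p < v')) ->
    exists x, forall t, u' <= t <= v' -> `|g t - g x| <= eta.
apply: (@cousin_induction _ Q) => [u v w uv vw [P1 HP1] [P2 HP2]|x].
  exists (v :: P1 ++ P2) => u' v' uu' uv' vw' noP.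
  have [v'v|vv'] := leP v' v.
    by apply: HP1 => // p pP; apply: noP; rewrite inE mem_cat pP orbT.
  have vu' : v <= u'.
    by have := noP v; rewrite inE eqxx vv' andbT -leNgt; exact.
  by apply: HP2 => // p pP; apply: noP; rewrite inE mem_cat pP !orbT.
have /cvgrPdist_le /(_ _ eta0) := gc x.
rewrite nearE => -[r /= r0 Hr].
exists r => // u v xu ux xv vx; exists [::] => u' v' uu' u'v' v'v _.
exists x => t /andP[ut tv]; rewrite distrC; apply: Hr => /=.
by rewrite ltr_norml; apply/andP; split; lra.
Qed.

Lemma locally_integrable_ocD (k1 k2 : R -> R) :
  locally_integrable_oc k1 -> locally_integrable_oc k2 ->
  locally_integrable_oc (fun t => k1 t + k2 t).
Proof. by move=> i1 i2 u v; exact: integrableD (i1 u v) (i2 u v). Qed.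

Lemma locally_integrable_oc_distr (k1 k2 : R -> R) :
  locally_integrable_oc k1 -> locally_integrable_oc k2 ->
  locally_integrable_oc (fun t => `|k1 t - k2 t|).
Proof.
move=> i1 i2 u v.
exact: (integrable_norm (integrableB _ (i1 u v) (i2 u v))).
Qed.

Lemma measurable_phi (eps : R) : measurable_fun setT (@phi R eps).
Proof.
apply: continuous_measurable_fun => t.
have sc : (eps^-1 * s @[s --> t] --> eps^-1 * t) by apply: cvgMr; exact: cvg_id.
rewrite /phi /Omega; apply: cvgMr; apply: cvgM; first exact: sc.
apply: cvgV; first by rewrite lt0r_neq0// ltr_wpDr// mulr_ge0.
apply: cvgD; first exact: cvg_cst.
by apply: cvgMr; exact: cvg_norm sc.
Qed.

Lemma locally_integrable_phi (eps : R) (f : R -> R) : 0 < eps ->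
  measurable_fun setT f -> (forall t, 0 <= f t) ->
  locally_integrable_oc f -> locally_integrable_oc (phi eps \o f).
Proof.
move=> eps0 mf f0 fi u v; apply: le_integrable (fi u v) => //.
  apply/measurable_EFinP/measurable_funTS.
  exact: measurableT_comp (measurable_phi eps) mf.
move=> t _ /=; rewrite lee_fin !ger0_norm ?phi_ge0//; exact: phi_le.
Qed.

(** The density is close in L^1 to a continuous function, itself nearly constant
    on the pieces of a subdivision.  The constant [c] of a piece serves for all
    its subintervals, with one additive error [e]; as [phi] is 1-Lipschitz on
    nonnegative numbers, the same [e] controls the integrals of [f] and of
    [phi f]. *)
Lemma density_approx (eps : R) (f : R -> R) (a b delta : R) : 0 < eps ->
  measurable_fun setT f -> (forall t, 0 <= f t) -> locally_integrable_oc f ->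
  a < b -> 0 < delta ->
  exists (P : seq R) (e : R -> R -> R),
    [/\ interval_content e, e a b <= delta &
      forall u v, a <= u -> u < v -> v <= b ->
        (forall p, p \in P -> ~~ (u < p < v)) ->
      exists2 c : R, 0 <= c & forall u' v', u <= u' -> u' <= v' -> v' <= v ->
        `|integral_oc f u' v' - c * (v' - u')| <= e u' v' /\
        `|integral_oc (phi eps \o f) u' v' - phi eps c * (v' - u')| <= e u' v'].
Proof.
move=> eps0 mf f0 fi ab delta0.
pose eta := delta / 2 / (b - a).
have eta0 : 0 < eta by rewrite !divr_gt0//; lra.
have [g gc gd] : exists2 g : R -> R, continuous g &
    integral_oc (fun t => `|f t - `|g t| |) a b <= delta / 2.
  have [|||g_ [gc gi g0]] :=
    @approximation_continuous_integrable R `]a, b]%classic f.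
  - by [].
  - exact: lebesgue_itvoc_lty.
  - by [].
  have d20 : 0 < delta / 2 by lra.
  move/fine_cvgP : g0 => [_ /cvgrPdist_lt /(_ _ d20) [N _ /(_ N (leqnn _))]].
  rewrite /= sub0r normrN => gN; exists (g_ N); first exact: gc.
  have gNi := continuous_integrable_oc (gc N).
  have gNi' : locally_integrable_oc (fun t => `|g_ N t|).
    by move=> u v; exact: integrable_norm (gNi u v).
  apply: (@le_trans _ _ (integral_oc (fun t => `|f t - g_ N t|) a b)).
    apply: le_Rintegral => //.
    - exact: (locally_integrable_oc_distr fi gNi' a b).
    - exact: (locally_integrable_oc_distr fi gNi a b).
    - move=> t _ /=.
      by rewrite -{1}(ger0_norm (f0 t)); exact: ler_dist_dist.
  apply/ltW; apply: le_lt_trans gN; exact: ler_norm.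
have agc : continuous (fun t => `|g t|).
  by move=> t; apply: cvg_norm; exact: gc.
have agi := continuous_integrable_oc agc.
have cti c : locally_integrable_oc (fun=> c : R).
  by apply: continuous_integrable_oc; exact: cst_continuous.
pose k t := `|f t - `|g t| | + eta.
have ki : locally_integrable_oc k.
  by apply: locally_integrable_ocD => //; exact: locally_integrable_oc_distr.
have phii := locally_integrable_phi eps0 mf f0 fi.
have [P HP] := continuous_cuts agc eta0 (ltW ab).
exists P, (integral_oc k); split.
- by apply: integral_oc_content => // t; rewrite addr_ge0// ltW.
- rewrite /integral_oc /k RintegralD//; last 2 first.
    exact: (locally_integrable_oc_distr fi agi a b).
    exact: (cti eta a b).
  rewrite -!/(integral_oc _ _ _) integral_oc_cst ?(ltW ab)//.
  rewrite /eta mulfVK ?subr_eq0 ?gt_eqF//; move: gd; lra.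
move=> u v au uv vb noP; have [x Hx] := HP u v au uv vb noP.
exists `|g x| => // u' v' uu u'v' vv.
have close t : u' < t <= v' -> `|f t - `|g x| | <= k t.
  move=> /andP[ut tv]; rewrite /k.
  apply: (le_trans (ler_distD `|g t| _ _)); rewrite lerD2l; apply: Hx.
  by apply/andP; split; lra.
split; first exact: integral_oc_approx.
apply: integral_oc_approx => // t /close; apply: le_trans.
exact: phi_lipschitz.
Qed.

End LocalApproximation.

(** * Localization of the singular part *)

Section SingularPart.
Context {R : realType}.
Notation lebesgue := (@lebesgue_measure R).

Lemma restricted_content (m : {measure set (measurableTypeR R) -> \bar R})
    (V : set (measurableTypeR R)) : measurable V ->
  (forall u v, (m (`]u, v]%classic `&` V) < +oo)%E) ->
  interval_content (fun u v => fine (m (`]u, v]%classic `&` V))).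
Proof.
move=> mV mfin; split=> [u v w uv vw|u v _]; last by rewrite fine_ge0.
rewrite (itvoc_setU uv vw) setIUl measureU ?fineD ?ge0_fin_numE//.
- exact: mfin.
- exact: mfin.
- exact: measurableI.
- exact: measurableI.
- by rewrite setIACA itvoc_disjoint set0I.
Qed.

(** Outer regularity through the covers that define Lebesgue measure; unlike
    an open set it comes with a sequence of intervals, of which finitely many
    are kept in [singular_cuts]. *)
Lemma lebesgue_null_cover (N : set R) (delta : R) :
  lebesgue N = 0%E -> 0 < delta ->
  exists ab : nat -> R * R, N `<=` \bigcup_k `](ab k).1, (ab k).2]%classic /\
    forall K, (\sum_(k < K) lebesgue `](ab k).1, (ab k).2]%classic <= delta%:E)%E.
Proof.
move=> N0 delta0.
have lN : ((@wlength R idfun)^* N)%mu = 0%E by exact: N0.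
have : ereal_inf [set (\sum_(k <oo) (@wlength R idfun) (F k))%E |
    F in open_itv_cover N]
    \is a fin_num by rewrite -outer_measure_open_itv_cover lN.
move=> /(lb_ereal_inf_adherent delta0) [_ [F [Fitv NF] <-]].
rewrite -outer_measure_open_itv_cover lN add0e => Fdelta.
have [ab abE] := choice Fitv.
exists ab; split.
  move=> t /NF [k _ Fkt]; exists k => //; move: Fkt; rewrite abE.
  exact: subset_itv_oo_oc.
move=> K; apply: (le_trans _ (ltW Fdelta)).
have lF k : lebesgue `](ab k).1, (ab k).2]%classic = (@wlength R idfun) (F k).
  by rewrite lebesgue_measure_itv abE wlength_itv.
under eq_bigr do rewrite lF.
rewrite -(big_mkord xpredT (fun k => (@wlength R idfun) (F k))).
by apply: nneseries_lim_ge => k _ _; exact: wlength_ge0.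
Qed.

Lemma piece_sub_itv (u v a b t : R) : ~~ (u < a < v) -> ~~ (u < b < v) ->
  u < t <= v -> a < t <= b -> a <= u /\ v <= b.
Proof.
rewrite !negb_and -!leNgt => n1 n2 /andP[ut tv] /andP[at_ tb]; split.
  by case/orP: n1 => ?; lra.
by case/orP: n2 => ?; lra.
Qed.

(** A finite union [V] of intervals of small total length carries almost all of
    the singular part.  Cutting at the endpoints of these intervals, each piece
    is either inside [V], where [sigma] dominates [eps] times the length, or
    disjoint from [V], where [sigma] dominates the singular mass. *)
Lemma singular_cuts (muS : {finite_measure set (measurableTypeR R) -> \bar R})
    (eps delta : R) : mutually_singular muS lebesgue ->
  0 < eps -> 0 < delta ->
  exists (P : seq R) (sigma : R -> R -> R),
    [/\ interval_content sigma, forall u v, sigma u v <= delta &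
      forall u v, u < v -> (forall p, p \in P -> ~~ (u < p < v)) ->
      (forall u' v', u <= u' -> v' <= v -> mass muS u' v' <= sigma u' v') \/
      (forall u' v', u <= u' -> u' <= v' -> v' <= v ->
         eps * (v' - u') <= sigma u' v')].
Proof.
move=> [N [mN muSN lN]] eps0 delta0.
have d0 : 0 < delta / 2 / eps by rewrite !divr_gt0.
have [ab [Nab abd]] := lebesgue_null_cover lN d0.
pose B k := `](ab k).1, (ab k).2]%classic.
pose V K := \big[setU/set0]_(k < K) B k.
have mV K : measurable (V K : set (measurableTypeR R)).
  by apply: bigsetU_measurable => k _; exact: measurable_itv.
have mVC K : measurable (~` V K : set (measurableTypeR R)) by exact: measurableC.
have capV : muS (\bigcap_K ~` V K) = 0%E.
  apply/eqP; rewrite eq_le measure_ge0 andbT -muSN le_measure ?inE//.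
  - exact: bigcapT_measurable.
  - exact: measurableC.
  move=> t Vt Nt; have [k _ abt] := Nab _ Nt.
  apply: (Vt k.+1 I); rewrite /V big_ord_recr /=; by right.
have [K muSV] : exists K, (muS (~` V K) < (delta / 2)%:E)%E.
  have : muS \o (fun K => ~` V K) @ \oo --> muS (\bigcap_K ~` V K).
    apply: nonincreasing_cvg_mu => //.
    - by rewrite ltey_eq fin_num_measure.
    - exact: bigcapT_measurable.
    - move=> m n mn; apply/subsetPset/subsetC.
      rewrite /V -!bigcup_mkord => t [k /= km kt]; exists k => //=.
      exact: leq_trans km mn.
  rewrite capV => /fine_cvgP[_ /cvgrPdist_lt /(_ (delta / 2))].
  move=> /(_ ltac:(lra)) [K _ /(_ K (leqnn K))] /=.
  rewrite sub0r normrN ger0_norm ?fine_ge0// => HK.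
  by exists K; rewrite -[X in (X < _)%E]fineK ?fin_num_measure// lte_fin.
have lV : (lebesgue (V K) <= (delta / 2 / eps)%:E)%E.
  apply: le_trans (abd K); apply: (Boole_inequality lebesgue (A := B)) => k _.
  exact: measurable_itv.
have lVfin A : measurable A -> (lebesgue (A `&` V K) <= (delta / 2 / eps)%:E)%E.
  move=> mA; apply: le_trans lV; apply: le_measure; rewrite ?inE//.
  exact: measurableI.
pose sigma u v := fine (muS (`]u, v]%classic `&` ~` V K)) +
  eps * fine (lebesgue (`]u, v]%classic `&` V K)).
have S1 : interval_content (fun u v => fine (muS (`]u, v]%classic `&` ~` V K))).
  apply: restricted_content => // u v.
  by rewrite ltey_eq fin_num_measure//; exact: measurableI.
have [S2D S20] :
    interval_content (fun u v => fine (lebesgue (`]u, v]%classic `&` V K))).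
  apply: restricted_content => // u v.
  by apply: le_lt_trans (lVfin _ _) _ => //; rewrite ltry.
exists (flatten [seq [:: (ab k).1; (ab k).2] | k <- iota 0 K]), sigma; split.
- split=> [u v w uv vw|u v uv].
    by rewrite /sigma (S1.1 _ _ _ uv vw) (S2D _ _ _ uv vw); ring.
  rewrite /sigma addr_ge0// ?mulr_ge0//; [exact: S1.2|exact: ltW|exact: S20].
- move=> u v; rewrite /sigma (splitr delta) lerD//.
    rewrite -lee_fin fineK ?fin_num_measure//; last exact: measurableI.
    apply: le_trans (ltW muSV); apply: le_measure; rewrite ?inE//.
    exact: measurableI.
  have -> : delta / 2 = eps * (delta / 2 / eps) by field; rewrite lt0r_neq0.
  rewrite ler_pM2l// -lee_fin fineK ?lVfin// ge0_fin_numE//.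
  by apply: le_lt_trans (lVfin _ _) _ => //; rewrite ltry.
move=> u v uv noP.
have noab k : (k < K)%N -> ~~ (u < (ab k).1 < v) /\ ~~ (u < (ab k).2 < v).
  move=> kK; split; apply: noP; apply/flatten_mapP; exists k;
    by rewrite ?mem_iota ?inE ?eqxx ?orbT.
have [[k [kK ku vk]]|noV] :=
  pselect (exists k, [/\ (k < K)%N, (ab k).1 <= u & v <= (ab k).2]).
  right=> u' v' uu u'v' vv; rewrite /sigma.
  have -> : `]u', v']%classic `&` V K = `]u', v']%classic.
    apply/setIidl => t /=; rewrite in_itv/= => /andP[ut tv].
    rewrite /V -bigcup_mkord; exists k => //=; rewrite /B /= in_itv/=.
    rewrite (le_lt_trans ku (le_lt_trans uu ut)).
    by rewrite (le_trans (le_trans tv vv) vk).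
  by rewrite lebesgue_itvoc// lerDr fine_ge0.
left=> u' v' uu vv; rewrite /sigma.
have -> : `]u', v']%classic `&` ~` V K = `]u', v']%classic.
  apply/setIidl => t /=; rewrite in_itv/= => /andP[ut tv].
  rewrite /V -bigcup_mkord => -[k kK]; rewrite /B /= in_itv/= => /andP[at_ tb].
  have [na nb] := noab _ kK; apply: noV; exists k.
  have utv : u < t <= v by rewrite (le_lt_trans uu ut) (le_trans tv vv).
  have abt : (ab k).1 < t <= (ab k).2 by rewrite at_ tb.
  by have [] := piece_sub_itv na nb utv abt.
by rewrite /mass lerDl; apply: mulr_ge0; [exact: ltW|exact: fine_ge0].
Qed.

End SingularPart.

(** * Lower bound on the number of atoms *)

Section DensityOfMu.
Context {R : realType}.
Notation lebesgue := (@lebesgue_measure R).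
Variables (mu : probability (measurableTypeR R) R)
  (muA muS : {finite_measure set (measurableTypeR R) -> \bar R})
  (eps : R) (f : R -> R).

(** A density of [muA] that is real-valued and nonnegative everywhere, together
    with the decomposition of [mu]. *)
Definition has_density : Prop :=
  [/\ measurable_fun setT f, (forall t, 0 <= f t),
      lebesgue.-integrable setT (EFin \o f),
      (forall A, measurable A -> mu A = (muA A + muS A)%E) &
      (forall A, measurable A -> muA A = (\int[lebesgue]_(t in A) (f t)%:E)%E)].

Hypothesis hd : has_density.

Lemma density_locally_integrable : locally_integrable_oc f.
Proof. by case: hd => _ _ fi _ _ u v; exact: integrableS fi. Qed.

Lemma massA_density u v : mass muA u v = integral_oc f u v.
Proof. by case: hd => _ _ _ _ hA; rewrite /mass hA. Qed.

Lemma massD u v : mass mu u v = mass muA u v + mass muS u v.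
Proof.
case: hd => _ _ _ hAS _; rewrite /mass hAS// fineD// fin_num_measure//.
Qed.

Lemma massA_le_open u v : mass muA u v <= fine (mu `]u, v[%classic).
Proof.
case: hd => mf _ _ hAS hA; rewrite /mass hAS// hA//.
rewrite -integral_itv_bndo_bndc; last exact/measurable_EFinP/measurable_funTS.
by rewrite -hA// fineD ?fin_num_measure// lerDl fine_ge0.
Qed.

End DensityOfMu.

Section LowerBound.
Context {R : realType}.
Implicit Types (u v y : R) (X : seq R).

(** The condition that the locations [X] must satisfy to support a measure
    within Levy distance [y]; see [admissible_gap]. *)
Definition gap_condition (eps : R) (m : set (measurableTypeR R) -> \bar R)
    y X : Prop :=
  forall u v, u < v -> (forall x, x \in X -> ~~ (u < x < v)) ->
    fine (m `]u + y / eps, v - y / eps[%classic) <= 2 * y.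

Lemma count_add_le (a1 a2 a3 a : pred R) X :
  (forall z, a1 z + a2 z + a3 z <= a z)%N ->
  (count a1 X + count a2 X + count a3 X <= count a X)%N.
Proof.
move=> a_le; elim: X => //= z X IH; have := a_le z; lia.
Qed.

Lemma counts_add y (n1 n2 n : nat) (h1 h2 e1 e2 : R) :
  0 <= y -> (n1 + n2 <= n)%N ->
  h1 <= 2 * y * n1%:R + 2 * e1 -> h2 <= 2 * y * n2%:R + 2 * e2 ->
  h1 + h2 <= 2 * y * n%:R + 2 * (e1 + e2).
Proof.
move=> y0; rewrite -(ler_nat R) natrD => n12.
have y20 : 0 <= 2 * y by lra.
have := ler_wpM2l y20 n12; lra.
Qed.

Variables (mu : probability (measurableTypeR R) R)
  (muA muS : {finite_measure set (measurableTypeR R) -> \bar R})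
  (eps : R) (f : R -> R).
Hypothesis eps_gt0 : 0 < eps.
Hypothesis hd : has_density mu muA muS f.

Notation H := (integral_oc (phi eps \o f)).

Lemma phi_content : interval_content H.
Proof.
case: (hd) => mf f0 _ _ _; apply: integral_oc_content.
  by move=> t; exact: phi_ge0.
by apply: locally_integrable_phi => //; exact: density_locally_integrable hd.
Qed.

(** One gap: the blind zones are removed from both ends of [u, v], and
    [gap_cost] is applied with the constant that approximates the density. *)
Lemma gap_bound c e u v y : 0 <= c -> interval_content e -> u <= v -> 0 <= y ->
  (forall u' v', u <= u' -> u' <= v' -> v' <= v ->
     `|integral_oc f u' v' - c * (v' - u')| <= e u' v' /\
     `|H u' v' - phi eps c * (v' - u')| <= e u' v') ->
  fine (mu `]u + y / eps, v - y / eps[%classic) <= 2 * y ->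
  H u v <= 2 * y + 2 * e u v.
Proof.
move=> c0 ec uv y0 he gap.
have euv0 : 0 <= e u v by exact: ec.2.
have [_] := he u v (lexx _) uv (lexx _).
rewrite ler_norml => /andP[_ Huv].
have r0 : 0 <= y / eps by rewrite divr_ge0// ltW.
suff : phi eps c * (v - u) <= 2 * y + e u v by lra.
apply: gap_cost => // ryv.
have ryv' : 2 * (y / eps) < v - u by rewrite mulrA.
rewrite -(mulrA 2).
move: r0 ryv' gap; set r := y / eps => r0 ryv' gap.
have := massA_le_open hd (u + r) (v - r); rewrite (massA_density hd) => le_gap.
have [||| + _] := he (u + r) (v - r); [lra..|].
rewrite ler_norml => /andP[lo _].
have : e (u + r) (v - r) <= e u v by apply: content_le => //; lra.
have -> : v - u - 2 * r = v - r - (u + r) by ring.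
lra.
Qed.

(** Splitting at a point of [X] inside [u, v] uses up that point, so that a
    piece with [N] interior points has [N + 1] gaps. *)
Lemma piece_bound c e u v y X : 0 <= c -> interval_content e -> u < v -> 0 < y ->
  (forall u' v', u <= u' -> u' <= v' -> v' <= v ->
     `|integral_oc f u' v' - c * (v' - u')| <= e u' v' /\
     `|H u' v' - phi eps c * (v' - u')| <= e u' v') ->
  gap_condition eps mu y X ->
  H u v <= 2 * y * (count (fun x => u < x < v) X + 1)%:R + 2 * e u v.
Proof.
move=> c0 ec uv y0 he gap.
have [n] := ubnP (count (fun x => u < x < v) X).
elim: n u v uv he => // n IH u v uv he; rewrite ltnS => cn.
have [hasX|noX] := boolP (has (fun x => u < x < v) X); last first.
  move: (noX); rewrite has_count -leqNgt leqn0 => /eqP ->.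
  rewrite add0n mulr1; apply: (gap_bound c0 ec _ _ he) => //; try exact: ltW.
  apply: gap => // x xX; apply: contra noX => uxv.
  by apply/hasP; exists x.
have /hasP[x xX /andP[ux xv]] := hasX.
have cx : (count (fun z => u < z < x)%R X + count (fun z => x < z < v)%R X + 1
     <= count (fun z => u < z < v)%R X)%N.
  apply: (@leq_trans (count (fun z => u < z < x)%R X +
     count (fun z => x < z < v)%R X + count_mem x X)).
    by rewrite leq_add2l -has_count has_pred1.
  apply: count_add_le => z /=.
  have [zx|xz|->] := ltgtP z x.
  - by rewrite (lt_trans zx xv) andbT !addn0.
  - by rewrite (lt_trans ux xz) andbF /= addn0.
  - by rewrite ux xv andbF.
rewrite (phi_content.1 u x v (ltW ux) (ltW xv)) (ec.1 u x v (ltW ux) (ltW xv)).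
have h1 : H u x <= 2 * y * (count (fun z => u < z < x) X + 1)%:R + 2 * e u x.
  apply: IH => //; last by clear -cx cn; lia.
  by move=> u' v' ? ? v'x; apply: he => //; rewrite (le_trans v'x)// ltW.
have h2 : H x v <= 2 * y * (count (fun z => x < z < v) X + 1)%:R + 2 * e x v.
  apply: IH => //; last by clear -cx cn; lia.
  by move=> u' v' xu' ? ?; apply: he => //; rewrite (le_trans _ xu')// ltW.
apply: (counts_add (ltW y0) _ h1 h2); clear -cx; lia.
Qed.

(** The constant [m] counts the pieces of the subdivision and depends neither
    on [y] nor on [X], so its contribution [2ym] vanishes as [y] tends to 0. *)
Lemma points_needed (a b delta : R) : a < b -> 0 < delta ->
  exists m : nat, forall y X, 0 < y -> gap_condition eps mu y X ->
    H a b <= 2 * y * (count (fun x => a < x < b) X + m)%:R + delta.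
Proof.
move=> ab delta0; case: (hd) => mf f0 _ _ _.
have fl := density_locally_integrable hd.
have d20 : 0 < delta / 2 by lra.
have [P [e [ec eab HP]]] := density_approx eps_gt0 mf f0 fl ab d20.
suff [m Hm] : exists m : nat, forall y X, 0 < y -> gap_condition eps mu y X ->
    H a b <= 2 * y * (count (fun x => a < x < b) X + m)%:R + 2 * e a b.
  exists m => y X y0 /(Hm _ _ y0); lra.
apply: (@cut_induction _ (fun u v => exists m : nat, forall y X, 0 < y ->
    gap_condition eps mu y X ->
    H u v <= 2 * y * (count (fun x => u < x < v) X + m)%:R + 2 * e u v) P) => //.
  move=> u v w au uv vw wb [m1 H1] [m2 H2].
  exists (m1 + m2)%N => y X y0 gap.
  rewrite (phi_content.1 u v w (ltW uv) (ltW vw)) (ec.1 u v w (ltW uv) (ltW vw)).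
  apply: (counts_add (ltW y0) _ (H1 y X y0 gap) (H2 y X y0 gap)).
  have : (count (fun z => u < z < v)%R X + count (fun z => v < z < w)%R X
     + count pred0 X <= count (fun z => u < z < w)%R X)%N.
    apply: count_add_le => z /=.
    have [zv|vz|->] := ltgtP z v.
    - by rewrite (lt_trans zv vw) andbT !addn0.
    - by rewrite (lt_trans uv vz) andbF /= addn0.
    - by rewrite andbF.
  by rewrite count_pred0; clear; lia.
move=> u v au uv vb noP; have [c c0 hc] := HP u v au uv vb noP.
by exists 1 => y X y0; exact: (piece_bound c0).
Qed.

End LowerBound.

(** * Upper bound on the number of greedy steps *)

Section UpperBound.
Context {R : realType}.
Notation lebesgue := (@lebesgue_measure R).
Implicit Types (u v y : R) (t : nat -> R) (J : set R).

(** The elementary move of the greedy sequence.  The blind zone comes last, so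
    that the steps from [t 0] to [t k] fill the half-open interval between
    these points. *)
Definition step (eps : R) (m : set (measurableTypeR R) -> \bar R) y u v : Prop :=
  u + 2 * y / eps <= v /\ 2 * y <= mass m u (v - 2 * y / eps).

(** The constant [l], which does not depend on [y], absorbs the steps that
    straddle two parts of [J]; it makes the bounds additive in [J], see
    [few_steps_cat]. *)
Definition few_steps (eps : R) (m : set (measurableTypeR R) -> \bar R)
    J (C : R) : Prop :=
  0 <= C /\ exists l : nat, forall y t k, 0 < y ->
    (forall j, (j < k)%N -> step eps m y (t j) (t j.+1)) ->
    J (t 0%N) -> J (t k) -> 2 * y * k%:R <= C + 2 * y * l%:R.

Variables (mu : probability (measurableTypeR R) R)
  (muA muS : {finite_measure set (measurableTypeR R) -> \bar R})
  (eps : R) (f : R -> R).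
Hypothesis eps_gt0 : 0 < eps.
Hypothesis hd : has_density mu muA muS f.

Notation H := (integral_oc (phi eps \o f)).

Lemma step_lt y u v : 0 < y -> step eps mu y u v -> u < v.
Proof.
move=> y0 [uv _]; apply: lt_le_trans uv.
by rewrite ltrDl divr_gt0// mulr_gt0.
Qed.

Lemma steps_le y t k i j : 0 < y ->
  (forall j, (j < k)%N -> step eps mu y (t j) (t j.+1)) ->
  (i <= j)%N -> (j <= k)%N -> t i <= t j.
Proof.
move=> y0 ht; elim: j => [|j IH]; first by rewrite leqn0 => /eqP ->.
rewrite leq_eqVlt => /predU1P[->//|ij] jk.
apply: (le_trans (IH ij (ltnW jk))); apply/ltW; exact: step_lt (ht j jk).
Qed.

Lemma steps_sum (nu : R -> R -> R) y t k : interval_content nu -> 0 < y ->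
  (forall j, (j < k)%N -> step eps mu y (t j) (t j.+1)) ->
  (forall j, (j < k)%N -> 2 * y <= nu (t j) (t j.+1)) ->
  2 * y * k%:R <= nu (t 0%N) (t k).
Proof.
move=> [nuD nu0] y0; elim: k => [|k IH] ht hnu; first by rewrite mulr0 nu0.
have t0k : t 0%N <= t k.
  by apply: (steps_le (k := k.+1) y0 ht).
rewrite (nuD _ (t k))//; last exact/ltW/(step_lt y0 (ht k (ltnSn k))).
rewrite -[k.+1%:R]natr1 mulrDr mulr1 lerD//.
  by apply: IH => j jk; [apply: ht|apply: hnu]; exact: ltnW.
exact: hnu.
Qed.

(** A sequence of steps crosses from [J1] to [J2] only once, and the crossing
    step is the only one that belongs to neither part. *)
Lemma few_steps_cat J J1 J2 C1 C2 : is_interval J ->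
  J `<=` J1 `|` J2 -> (forall u v, J1 u -> J2 v -> u <= v) ->
  few_steps eps mu J1 C1 -> few_steps eps mu J2 C2 ->
  few_steps eps mu J (C1 + C2).
Proof.
move=> itvJ JJ J12 [C10 [l1 H1]] [C20 [l2 H2]].
split; first exact: addr_ge0.
exists (l1 + l2 + 1)%N => y t k y0 ht Jt0 Jtk.
have y20 : 0 <= 2 * y by lra.
have l10 : 0 <= 2 * y * l1%:R by rewrite mulr_ge0.
have l20 : 0 <= 2 * y * l2%:R by rewrite mulr_ge0.
rewrite !natrD !mulrDr mulr1.
have [J2t0|J2t0] := pselect (J2 (t 0%N)).
  have [J2tk|J2tk] := pselect (J2 (t k)).
    by have := H2 y t k y0 ht J2t0 J2tk; clear -C10 l10 y20; lra.
  have J1tk : J1 (t k) by case: (JJ _ Jtk).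
  case: k ht Jtk J2tk J1tk => [//|k] ht _ _ J1tk.
  have := J12 _ _ J1tk J2t0; have : t 0%N < t k.+1.
    apply: (@lt_le_trans _ _ (t 1%N)); first exact: step_lt (ht 0%N isT).
    by apply: (steps_le y0 ht).
  by move=> /lt_le_trans /[apply]; rewrite ltxx.
have J1t0 : J1 (t 0%N) by case: (JJ _ Jt0).
have [J2tk|J2tk] := pselect (J2 (t k)); last first.
  have J1tk : J1 (t k) by case: (JJ _ Jtk).
  by have := H1 y t k y0 ht J1t0 J1tk; clear -C20 l20 y20; lra.
(* The first step that reaches [J2] is the crossing one. *)
have ex2 : exists i, `[< J2 (t i) >] by exists k; apply/asboolP.
case: (ex_minnP ex2) => -[|i]; first by move/asboolP.
move=> /asboolP J2i imin.
have ik : (i < k)%N by apply: imin; apply/asboolP.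
have J1i : J1 (t i).
  have Ji : J (t i).
    apply: (itvJ (t 0%N) (t k)) => //; apply/andP; split.
      by apply: (steps_le y0 ht) => //; exact: ltnW.
    by apply: (steps_le y0 ht) => //; exact: ltnW.
  case: (JJ _ Ji) => // J2ti.
  by have := imin i (introT (asboolP _) J2ti); rewrite ltnn.
have h1 : 2 * y * i%:R <= C1 + 2 * y * l1%:R.
  by apply: (H1 y t i) => // j ji; apply: ht; apply: ltn_trans ik.
have h2 : 2 * y * (k - i.+1)%:R <= C2 + 2 * y * l2%:R.
  apply: (H2 y (fun j => t (j + i.+1)%N)) => //; last by rewrite subnK.
  by move=> j jk; rewrite addSn; apply: ht; clear -jk; lia.
have -> : k%:R = i%:R + 1 + (k - i.+1)%:R :> R.
  by rewrite natrB// -natr1; ring.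
by clear -h1 h2 y20; lra.
Qed.

(** Steps are disjoint and each carries mass [2y]; this crude bound is used
    on the two tails of the line. *)
Lemma few_steps_mass J : is_interval J -> few_steps eps mu J (fine (mu J)).
Proof.
move=> itvJ; split; first by rewrite fine_ge0.
exists 0%N => y t k y0 ht Jt0 Jtk; rewrite mulr0 addr0.
apply: (@le_trans _ _ (mass mu (t 0%N) (t k))).
  apply: steps_sum => //; first exact: mass_content.
  move=> j jk; have [le2 m2] := ht j jk; apply: (le_trans m2).
  have r0 : 0 <= 2 * y / eps by rewrite divr_ge0// ?ltW// mulr_gt0.
  apply: content_le => //; first exact: mass_content.
  - by rewrite lerBrDr.
  - by rewrite gerBl.
apply: fine_le_measure => //; first exact: is_interval_measurable.
move=> s /=; rewrite in_itv/= => /andP[ts st].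
by apply: (itvJ (t 0%N) (t k)) => //; rewrite st ltW.
Qed.

(** On a piece where the singular mass is small, [step_cost] applies; on a piece
    covered by a short set, the blind zone alone accounts for [2y]. *)
Lemma step_bound c e sigma u v y : 0 <= c -> interval_content e ->
  interval_content sigma -> 0 < y ->
  (forall u' v', u <= u' -> u' <= v' -> v' <= v ->
     `|integral_oc f u' v' - c * (v' - u')| <= e u' v' /\
     `|H u' v' - phi eps c * (v' - u')| <= e u' v') ->
  (forall u' v', u <= u' -> v' <= v -> mass muS u' v' <= sigma u' v') \/
  (forall u' v', u <= u' -> u' <= v' -> v' <= v ->
     eps * (v' - u') <= sigma u' v') ->
  step eps mu y u v -> 2 * y <= H u v + 2 * e u v + sigma u v.
Proof.
move=> c0 ec sc y0 he hs [uv my].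
have rE : eps * (2 * y / eps) = 2 * y by field; rewrite lt0r_neq0.
have r0 : 0 <= 2 * y / eps by rewrite divr_ge0// ?ltW// mulr_gt0.
move: rE r0 uv my; set r := 2 * y / eps => rE r0 uv my.
have uv' : u <= v by lra.
have euv0 : 0 <= e u v by exact: ec.2.
have Huv0 : 0 <= H u v by exact: (phi_content eps_gt0 hd).2.
case: hs => hs; last first.
  have := hs u v (lexx _) uv' (lexx _).
  have := @ler_wpM2l _ eps (ltW eps_gt0) r (v - u).
  rewrite rE => /(_ ltac:(lra)); lra.
have [_] := he u v (lexx _) uv' (lexx _); rewrite ler_norml => /andP[Huv _].
have [||| + _] := he u (v - r); [lra..|].
rewrite ler_norml => /andP[_ Fle].
have sle : mass muS u (v - r) <= sigma u v.
  apply: (le_trans (hs _ _ _ _)); [exact: lexx|lra|].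
  by apply: content_le => //; lra.
have ele : e u (v - r) <= e u v by apply: content_le => //; lra.
have suv0 : 0 <= sigma u v by exact: sc.2.
have : 2 * y <= phi eps c * (v - r - u + 2 * y / eps) + (e u v + sigma u v).
  apply: step_cost => //; first lra.
  by move: my; rewrite (massD hd) (massA_density hd); lra.
by rewrite -/r (_ : v - r - u + r = v - u); [lra|ring].
Qed.

(** The pieces of the two subdivisions are combined, and on each of them the
    bound for a single step is summed along the sequence. *)
Lemma few_steps_itvoc (a b delta : R) : mutually_singular muS lebesgue ->
  a < b -> 0 < delta -> few_steps eps mu `]a, b]%classic (H a b + delta).
Proof.
move=> sing ab delta0; case: (hd) => mf f0 _ _ _.
have fl := density_locally_integrable hd.
have d40 : 0 < delta / 4 by lra.
have d20 : 0 < delta / 2 by lra.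
have [P [e [ec eab HP]]] := density_approx eps_gt0 mf f0 fl ab d40.
have [P' [sigma [sc sle HP']]] := singular_cuts sing eps_gt0 d20.
have Hc := phi_content eps_gt0 hd.
pose nu u v := H u v + 2 * e u v + sigma u v.
have nuc : interval_content nu.
  split=> [u v w uv vw|u v uv]; rewrite /nu.
    by rewrite (Hc.1 u v w)// (ec.1 u v w)// (sc.1 u v w)//; ring.
  by have := Hc.2 u v uv; have := ec.2 u v uv; have := sc.2 u v uv; lra.
suff [nu0 [l Hl]] : few_steps eps mu `]a, b]%classic (nu a b).
  have le : nu a b <= H a b + delta by rewrite /nu; have := sle a b; lra.
  split; first exact: le_trans le.
  exists l => y t k y0 ht t0 tk.
  by apply: le_trans (Hl y t k y0 ht t0 tk) _; rewrite lerD2r.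
apply: (@cut_induction _
  (fun u v => few_steps eps mu `]u, v]%classic (nu u v)) (P ++ P')) => //.
  move=> u v w au uv vw wb F1 F2; rewrite (nuc.1 u v w (ltW uv) (ltW vw)).
  apply: few_steps_cat F1 F2; first exact: interval_is_interval.
  - by rewrite (itvoc_setU (ltW uv) (ltW vw)).
  - move=> p q /=; rewrite !in_itv/= => /andP[_ pv] /andP[vq _].
    exact: le_trans pv (ltW vq).
move=> u v au uv vb noP.
split; first exact/nuc.2/ltW.
exists 0%N => y t k y0 ht; rewrite /= !in_itv/= => /andP[ut0 _] /andP[_ tkv].
rewrite mulr0 addr0.
have [|c c0 hc] := HP u v au uv vb.
  by move=> p pP; apply: noP; rewrite mem_cat pP.
have noP' p : p \in P' -> ~~ (u < p < v).
  by move=> pP; apply: noP; rewrite mem_cat pP orbT.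
have hS := HP' u v uv noP'.
have t0k : t 0%N <= t k by apply: (steps_le y0 ht).
apply: (@le_trans _ _ (nu (t 0%N) (t k))); last exact: content_le (ltW _) _ _.
apply: steps_sum => // j jk.
have utj : u <= t j.
  by apply: (le_trans (ltW ut0)); apply: (steps_le y0 ht) => //; exact: ltnW.
have tjv : t j.+1 <= v by apply: le_trans tkv; apply: (steps_le y0 ht).
apply: (step_bound c0 ec sc y0); last exact: ht.
  move=> u' v' uu u'v' vv; apply: hc => //.
    exact: le_trans uu.
  exact: le_trans vv _.
case: hS => hS; [left|right] => u' v' uu; last move=> u'v'; move=> vv;
  apply: hS => //;
  first [exact: le_trans uu|exact: le_trans vv _].
Qed.

End UpperBound.

(** * Continuity of finite measures along intervals, and the greedy sequence *)

Section MeasureLimits.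
Context {R : realType}.
Variable m : {finite_measure set (measurableTypeR R) -> \bar R}.
Implicit Types (F : nat -> set (measurableTypeR R)) (q s t : R).

Lemma measure_bigcup_le F q : (forall n, measurable (F n)) ->
  {homo F : i j / (i <= j)%N >-> i `<=` j} -> (forall n, fine (m (F n)) <= q) ->
  fine (m (\bigcup_n F n)) <= q.
Proof.
move=> mF ndF Fq.
have : m \o F @ \oo --> m (\bigcup_n F n).
  apply: nondecreasing_cvg_mu => //; first exact: bigcupT_measurable.
  by move=> i j ij; apply/subsetPset/ndF.
have := fin_num_measure m (\bigcup_n F n) (bigcupT_measurable _ mF).
move=> /fineK <- /fine_cvgP[_ cvgF].
have <- := cvg_lim (@Rhausdorff R) cvgF.
apply: limr_le; first by apply/cvg_ex; eexists; exact: cvgF.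
by near=> n; exact: Fq.
Unshelve. all: by end_near. Qed.

Lemma measure_bigcap_ge F q : (forall n, measurable (F n)) ->
  {homo F : i j / (i <= j)%N >-> j `<=` i} -> (forall n, q <= fine (m (F n))) ->
  q <= fine (m (\bigcap_n F n)).
Proof.
move=> mF niF Fq.
have : m \o F @ \oo --> m (\bigcap_n F n).
  apply: nonincreasing_cvg_mu => //; first by rewrite ltey_eq fin_num_measure.
    exact: bigcapT_measurable.
  by move=> i j ij; apply/subsetPset/niF.
have := fin_num_measure m (\bigcap_n F n) (bigcapT_measurable mF).
move=> /fineK <- /fine_cvgP[_ cvgF].
have <- := cvg_lim (@Rhausdorff R) cvgF.
apply: limr_ge; first by apply/cvg_ex; eexists; exact: cvgF.
by near=> n; exact: Fq.
Unshelve. all: by end_near. Qed.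

Lemma invSn_le (i j : nat) : (i <= j)%N -> j.+1%:R^-1 <= i.+1%:R^-1 :> R.
Proof. by move=> ij; rewrite lef_pV2 ?posrE// ler_nat ltnS. Qed.

Lemma exists_invSn_lt (r : R) : 0 < r -> exists n : nat, n.+1%:R^-1 < r.
Proof.
move=> r0; exists (Num.truncn r^-1).
by rewrite invf_plt ?posrE// truncnS_gt.
Qed.

Lemma mass_left_limit t s q : (forall s', s' < s -> mass m t s' <= q) ->
  fine (m `]t, s[%classic) <= q.
Proof.
move=> msq; pose F n := `]t, s - n.+1%:R^-1]%classic : set (measurableTypeR R).
have -> : `]t, s[%classic = \bigcup_n F n.
  apply/seteqP; split=> [z|z [n _]]; rewrite /F /= !in_itv/=.
    move=> /andP[tz zs]; have [n zn] := @exists_invSn_lt (s - z) ltac:(lra).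
    by exists n => //=; rewrite in_itv/= tz /= lerBrDr -lerBrDl ltW.
  have : 0 < n.+1%:R^-1 :> R by rewrite invr_gt0.
  by move: (n.+1%:R^-1) => r r0 /andP[-> ?] /=; lra.
apply: measure_bigcup_le => [n|i j ij z|n].
- exact: measurable_itv.
- rewrite /F /= !in_itv/= => /andP[-> +] /=; have := invSn_le ij.
  move: (i.+1%:R^-1) (j.+1%:R^-1) => r1 r2; lra.
- by apply: msq; rewrite ltrBlDr ltrDl invr_gt0.
Qed.

Lemma mass_right_limit t s q : (forall s', s < s' -> q <= mass m t s') ->
  q <= mass m t s.
Proof.
move=> msq; pose F n := `]t, s + n.+1%:R^-1]%classic : set (measurableTypeR R).
rewrite /mass; have -> : `]t, s]%classic = \bigcap_n F n.
  apply/seteqP; split=> [z|z Fz]; rewrite /F /= !in_itv/=.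
    move=> /andP[tz zs] n _ /=; rewrite in_itv/= tz.
    have : 0 < n.+1%:R^-1 :> R by rewrite invr_gt0.
    by move: (n.+1%:R^-1) => r r0 /=; lra.
  have := Fz 0%N I; rewrite /F /= in_itv/= => /andP[-> _] /=.
  rewrite leNgt; apply/negP => sz.
  have [n zn] := @exists_invSn_lt (z - s) ltac:(lra).
  have := Fz n I; rewrite /F /= in_itv/= => /andP[_]; move: zn.
  move: (n.+1%:R^-1) => r; lra.
apply: measure_bigcap_ge => [n|i j ij z|n].
- exact: measurable_itv.
- rewrite /F /= !in_itv/= => /andP[-> +] /=; have := invSn_le ij.
  move: (i.+1%:R^-1) (j.+1%:R^-1) => r1 r2; lra.
- by apply: msq; rewrite ltrDl invr_gt0.
Qed.

Lemma mass_pinfty_limit t q : (forall s, mass m t s <= q) ->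
  fine (m `]t, +oo[%classic) <= q.
Proof.
move=> msq; pose F n := `]t, n%:R]%classic : set (measurableTypeR R).
have -> : `]t, +oo[%classic = \bigcup_n F n.
  apply/seteqP; split=> [z|z [n _]]; rewrite /F /= !in_itv/= ?andbT.
    move=> tz; exists (Num.truncn z).+1 => //=; rewrite in_itv/= tz.
    exact/ltW/truncnS_gt.
  by move=> /andP[].
apply: measure_bigcup_le => [n|i j ij z|n].
- exact: measurable_itv.
- rewrite /F /= !in_itv/= => /andP[-> zi] /=; apply: (le_trans zi).
  by rewrite ler_nat.
- exact: msq.
Qed.

Lemma left_tail q : 0 < q -> exists s, fine (m `]-oo, s]%classic) <= q.
Proof.
move=> q0; apply: contrapT => /forallNP big.
pose F (n : nat) := `]-oo, - n%:R]%classic : set (measurableTypeR R).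
suff : q <= fine (m (\bigcap_n F n)).
  have -> : \bigcap_n F n = set0.
    apply/seteqP; split => // z Fz.
    have := Fz (Num.truncn (- z)).+1 I; rewrite /F /= in_itv/= leNgt.
    by rewrite ltrNl truncnS_gt.
  by rewrite measure0 /= leNgt q0.
apply: measure_bigcap_ge => [n|i j ij z|n].
- exact: measurable_itv.
- rewrite /F /= !in_itv/= => zi; apply: (le_trans zi).
  by rewrite lerN2 ler_nat.
- by apply/ltW; rewrite ltNge; apply/negP/big.
Qed.

Lemma right_tail q : 0 < q -> exists s, fine (m `]s, +oo[%classic) <= q.
Proof.
move=> q0; apply: contrapT => /forallNP big.
pose F (n : nat) := `]n%:R, +oo[%classic : set (measurableTypeR R).
suff : q <= fine (m (\bigcap_n F n)).
  have -> : \bigcap_n F n = set0.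
    apply/seteqP; split => // z Fz.
    have := Fz (Num.truncn z).+1 I; rewrite /F /= in_itv/= andbT.
    by rewrite ltNge ltW// truncnS_gt.
  by rewrite measure0 /= leNgt q0.
apply: measure_bigcap_ge => [n|i j ij z|n].
- exact: measurable_itv.
- rewrite /F /= !in_itv/= !andbT; apply: le_lt_trans.
  by rewrite ler_nat.
- by apply/ltW; rewrite ltNge; apply/negP/big.
Qed.

(** An atom of the measure may straddle the level [q]: this is why the open
    interval is bounded from above and the half-open one from below. *)
Lemma quantile t q : 0 < q -> q < fine (m `]t, +oo[%classic) ->
  exists s, [/\ t <= s, fine (m `]t, s[%classic) <= q & q <= mass m t s].
Proof.
move=> q0 qlt; pose S := [set s | mass m t s <= q].
have St : S t by rewrite /S /= /mass set_itvoc0 measure0 /= ltW.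
have hS : has_sup S.
  split; first by exists t.
  have [s qs] : exists s, q < mass m t s.
    apply: contrapT => /forallNP le_q; move: qlt; rewrite ltNge => /negP; apply.
    by apply: mass_pinfty_limit => s; rewrite leNgt; apply/negP/le_q.
  exists s => s' /= Ss'; rewrite leNgt; apply/negP => ss'.
  suff : mass m t s <= mass m t s' by rewrite leNgt (le_lt_trans Ss' qs).
  apply: fine_le_measure => //.
  by apply: subset_itvl; rewrite bnd_simp ltW.
have ts : t <= sup S by apply: ub_le_sup => //; case: hS.
exists (sup S); split => //.
  apply: mass_left_limit => s' ss'.
  have [s Ss lt_s] := sup_adherent (eps := sup S - s') ltac:(lra) hS.
  apply: le_trans Ss; apply: fine_le_measure => //.
  by apply: subset_itvl; rewrite bnd_simp ltW//; lra.
apply: mass_right_limit => s' ss'; rewrite leNgt; apply/negP => /ltW Ss'.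
have : s' <= sup S by apply: ub_le_sup => //; case: hS.
by rewrite leNgt ss'.
Qed.

End MeasureLimits.

Section Greedy.
Context {R : realType}.
Notation lebesgue := (@lebesgue_measure R).
Variables (mu : probability (measurableTypeR R) R)
  (muA muS : {finite_measure set (measurableTypeR R) -> \bar R})
  (eps : R) (f : R -> R).
Hypothesis eps_gt0 : 0 < eps.
Hypothesis hd : has_density mu muA muS f.

Lemma phi_integrable : lebesgue.-integrable setT (EFin \o (phi eps \o f)).
Proof.
case: hd => mf f0 fi _ _; apply: le_integrable fi => //.
  apply/measurable_EFinP; exact: measurableT_comp (measurable_phi eps) mf.
by move=> t _ /=; rewrite lee_fin !ger0_norm ?phi_ge0//; exact: phi_le.
Qed.

Lemma phi_integral_le (A B : set (measurableTypeR R)) :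
  measurable A -> measurable B -> A `<=` B ->
  \int[lebesgue]_(t in A) phi eps (f t) <= \int[lebesgue]_(t in B) phi eps (f t).
Proof.
move=> mA mB AB; case: (hd) => mf f0 _ _ _.
apply: fine_le.
- apply: integrable_fin_num => //; exact: integrableS phi_integrable.
- apply: integrable_fin_num => //; exact: integrableS phi_integrable.
apply: ge0_subset_integral => //.
  apply: measurable_int; exact: integrableS phi_integrable.
by move=> t _; rewrite lee_fin phi_ge0.
Qed.

(** Two tails of mass at most [delta / 3] reduce the line to a bounded
    interval. *)
Lemma few_steps_total (delta : R) : mutually_singular muS lebesgue -> 0 < delta ->
  few_steps eps mu setT (\int[lebesgue]_t phi eps (f t) + delta).
Proof.
move=> sing delta0; have d30 : 0 < delta / 3 by lra.
have [a ha] := left_tail mu d30.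
have [s hs] := right_tail mu d30.
pose b := Num.max s (a + 1).
have ab : a < b by rewrite lt_max; apply/orP; right; lra.
have hb : fine (mu `]b, +oo[%classic) <= delta / 3.
  apply: le_trans hs; apply: fine_le_measure => //.
  by apply: subset_itvr; rewrite bnd_simp le_max lexx.
have Fl : few_steps eps mu `]-oo, a]%classic (fine (mu `]-oo, a]%classic)).
  by apply: few_steps_mass => //; exact: interval_is_interval.
have Fr : few_steps eps mu `]b, +oo[%classic (fine (mu `]b, +oo[%classic)).
  by apply: few_steps_mass => //; exact: interval_is_interval.
have Fm := few_steps_itvoc eps_gt0 hd sing ab d30.
have Fmr : few_steps eps mu `]a, +oo[%classic
    (integral_oc (phi eps \o f) a b + delta / 3 + fine (mu `]b, +oo[%classic)).
  apply: (few_steps_cat eps_gt0 _ _ _ Fm Fr) => //; first exact: interval_is_interval.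
    by rewrite -itv_bndbnd_setU ?bnd_simp// ltW.
  move=> p q /=; rewrite !in_itv/= andbT => /andP[_ pb] bq.
  exact: le_trans pb (ltW bq).
have Ft : few_steps eps mu setT (fine (mu `]-oo, a]%classic) +
    (integral_oc (phi eps \o f) a b + delta / 3 + fine (mu `]b, +oo[%classic))).
  apply: (few_steps_cat eps_gt0 _ _ _ Fl Fmr) => //.
    by move=> z _; rewrite -itv_bndbnd_setU ?bnd_simp.
  move=> p q /=; rewrite !in_itv/= andbT => pa aq.
  exact: le_trans pa (ltW aq).
have le_tot : integral_oc (phi eps \o f) a b <= \int[lebesgue]_t phi eps (f t).
  exact: phi_integral_le.
case: Ft => C0 [l Hl]; split.
  apply: (le_trans C0); move: ha hb le_tot.
  set x1 := fine _; set x2 := fine _; lra.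
exists l => y t k y0 ht h0 hk; apply: le_trans (Hl y t k y0 ht h0 hk) _.
rewrite lerD2r; move: ha hb le_tot.
set x1 := fine _; set x2 := fine _; lra.
Qed.

Lemma next_step (y t : R) : 0 < y -> 2 * y < fine (mu `]t, +oo[%classic) ->
  exists t', step eps mu y t t' /\
    fine (mu `]t, t' - 2 * y / eps[%classic) <= 2 * y.
Proof.
move=> y0 tail.
have y20 : 0 < 2 * y by lra.
have [s [ts sl sr]] := quantile y20 tail.
exists (s + 2 * y / eps); rewrite /step addrK.
by split=> //; split=> //; rewrite lerD2r.
Qed.

(** Blind zones are placed as late as the bound [2y] on the gaps allows; the
    process stops because every step consumes mass [2y]. *)
Lemma greedy_steps (y t0 : R) : 0 < y -> exists (t : nat -> R) (k : nat),
  [/\ t 0%N = t0,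
      forall j, (j < k)%N -> step eps mu y (t j) (t j.+1),
      forall j, (j < k)%N ->
        fine (mu `]t j, t j.+1 - 2 * y / eps[%classic) <= 2 * y &
      fine (mu `]t k, +oo[%classic) <= 2 * y].
Proof.
move=> y0.
have /choice[nx Hnx] : forall t, exists t', 2 * y < fine (mu `]t, +oo[%classic) ->
    step eps mu y t t' /\ fine (mu `]t, t' - 2 * y / eps[%classic) <= 2 * y.
  move=> t; have [tail|] := ltP (2 * y) (fine (mu `]t, +oo[%classic)).
    by have [t' ?] := next_step y0 tail; exists t'.
  by exists t.
pose t k := iter k nx t0.
have tS k : t k.+1 = nx (t k) by [].
have ex_k : exists k, fine (mu `]t k, +oo[%classic) <= 2 * y.
  apply: contrapT => /forallNP big.
  have ht j : step eps mu y (t j) (t j.+1).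
    by rewrite tS; apply: (Hnx _ _).1; rewrite ltNge; apply/negP/big.
  (* A sequence of steps that never meets the stopping criterion would collect
     more than the total mass. *)
  have [_ [l Hl]] := @few_steps_mass _ mu _ eps_gt0 setT (fun _ _ _ _ _ _ => I).
  pose k := (l + Num.truncn (fine (mu setT) / (2 * y))).+1%N.
  have := Hl y t k y0 (fun j _ => ht j) I I.
  have := truncnS_gt (fine (mu setT) / (2 * y)).
  rewrite ltr_pdivrMr ?mulr_gt0// /k -addnS natrD.
  set c := fine _; set T := _.+1%:R; lra.
case: (ex_minnP ex_k) => k tk kmin; exists t, k.
have big j : (j < k)%N -> 2 * y < fine (mu `]t j, +oo[%classic).
  by move=> jk; rewrite ltNge; apply/negP => /kmin; rewrite leqNgt jk.
by split=> // j jk; rewrite tS; have [] := Hnx _ (big j jk).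
Qed.

End Greedy.

(** * Levy distance to a finitely supported measure *)

Section LevyDistance.
Context {R : realType}.
Variables (mu : probability (measurableTypeR R) R) (eps : R).
Hypothesis eps_gt0 : 0 < eps.

Lemma Fdist_delta n (x p : 'rV[R]_n) t :
  Fdist (delta x p) t = \sum_(j < n) p ord0 j * (x ord0 j <= t)%R%:R.
Proof.
rewrite /Fdist /delta; under eq_bigr do rewrite diracE -EFinM.
rewrite sumEFin /=; apply: eq_bigr => j _; congr (_ * (_ : bool)%:R).
by apply/idP/idP; rewrite inE /= in_itv.
Qed.

Lemma Fdist_delta_itv n (x p : 'rV[R]_n) t : Pi p ->
  0 <= Fdist (delta x p) t <= 1.
Proof.
move=> [p0 p1]; rewrite Fdist_delta; apply/andP; split.
  by apply: sumr_ge0 => j _; rewrite mulr_ge0.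
by rewrite -[leRHS]p1; apply: ler_sum => j _; rewrite ler_piMr// lern1 leq_b1.
Qed.

Lemma Fdist_ge0 t : 0 <= Fdist mu t.
Proof. by rewrite /Fdist fine_ge0. Qed.

Lemma Fdist_left_le1 t : Fdist_left mu t <= 1.
Proof.
by rewrite /Fdist_left -lee_fin fineK ?fin_num_measure// probability_le1.
Qed.

Lemma Fdist_left_le (s t : R) : s <= t -> Fdist_left mu s <= Fdist_left mu t.
Proof.
by move=> st; apply: fine_le_measure => //; apply: subset_itvl; rewrite bnd_simp.
Qed.

Lemma Fdist_le (s t : R) : s <= t -> Fdist mu s <= Fdist mu t.
Proof.
by move=> st; apply: fine_le_measure => //; apply: subset_itvl; rewrite bnd_simp.
Qed.

Lemma Fdist_leftD (s t : R) : s < t ->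
  Fdist_left mu t = Fdist mu s + fine (mu `]s, t[%classic).
Proof.
move=> st; rewrite /Fdist_left /Fdist -fine_measureU//.
  by rewrite -itv_bndbnd_setU ?bnd_simp.
apply/seteqP; split => // z /=; rewrite !in_itv/= => -[zs /andP[sz _]].
by move: sz; rewrite ltNge zs.
Qed.

Lemma FdistC (s : R) : Fdist mu s + fine (mu `]s, +oo[%classic) = 1.
Proof.
rewrite /Fdist -fine_measureU//; last first.
  apply/seteqP; split => // z /=; rewrite !in_itv/= andbT => -[zs sz].
  by move: sz; rewrite ltNge zs.
have -> : `]-oo, s] `|` `]s, +oo[ = [set: R].
  by rewrite -itv_bndbnd_setU ?bnd_simp// set_itvE.
by transitivity (fine (1%E : \bar R)) => //; congr fine; exact: probability_setT.
Qed.

Definition levy_admissible (m nu : set R -> \bar R) (y : R) : Prop :=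
  0 < y /\ forall x : R,
    Fdist_left m (x - y / eps) - y <= Fdist nu x <= Fdist m (x + y / eps) + y.

Lemma levy_distE (m nu : set R -> \bar R) :
  levy_dist eps m nu = inf (levy_admissible m nu).
Proof. by []. Qed.

Lemma levy_admissible_lbound (m nu : set R -> \bar R) :
  has_lbound (levy_admissible m nu).
Proof. by exists 0 => y [/ltW]. Qed.

Lemma levy_dist_ge0 (m nu : set R -> \bar R) : 0 <= levy_dist eps m nu.
Proof.
rewrite levy_distE; have [->|/set0P ne] := eqVneq (levy_admissible m nu) set0.
  by rewrite inf0.
by apply: lb_le_inf => // y [/ltW].
Qed.

Lemma levy_admissible1 n (x p : 'rV[R]_n) : Pi p ->
  levy_admissible mu (delta x p) 1.
Proof.
move=> pP; split=> // t; have /andP[F0 F1] := Fdist_delta_itv x t pP.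
have := Fdist_left_le1 (t - 1 / eps); have := Fdist_ge0 (t + 1 / eps).
by move=> h1 h2; apply/andP; split; lra.
Qed.

Lemma gap_condition_mono y y' (X : seq R) : y <= y' ->
  gap_condition eps mu y X -> gap_condition eps mu y' X.
Proof.
move=> yy gap u v uv noX.
apply: (@le_trans _ _ (2 * y)); last lra.
apply: le_trans (gap u v uv noX); apply: fine_le_measure => //.
have ryy : y / eps <= y' / eps by rewrite ler_pM2r// invr_gt0.
by apply: subset_itv; rewrite bnd_simp; lra.
Qed.

(** Between two consecutive atoms the distribution function of the
    approximation is constant, so both inequalities that define the Levy
    distance apply to the same value at the two ends of the gap. *)
Lemma admissible_gap n (x p : 'rV[R]_n) y :
  levy_admissible mu (delta x p) y ->
  gap_condition eps mu y [seq x ord0 j | j <- enum 'I_n].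
Proof.
move=> [y0 adm] u v uv noX; set r := y / eps.
have r0 : 0 < r by rewrite divr_gt0.
apply: mass_left_limit => s' s'v.
have [su|us] := leP s' (u + r).
  by rewrite /mass set_itv_ge ?bnd_simp -?leNgt// measure0 /= mulr_ge0// ltW.
(* Any point strictly between [s' + r] and [v] would do: [s] has to lie in
   the gap while [s - r] exceeds [s']. *)
pose s := (s' + r + v) / 2.
have Fus : Fdist (delta x p) s = Fdist (delta x p) u.
  rewrite !Fdist_delta; apply: eq_bigr => j _; congr (_ * (_ : bool)%:R).
  have := noX (x ord0 j) (map_f _ (mem_enum _ j)).
  rewrite negb_and -!leNgt => /orP[xu|vx].
    by rewrite xu (le_trans xu)// /s; lra.
  by rewrite !leNgt (lt_le_trans uv vx) (lt_le_trans _ vx)// /s; lra.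
have /andP[lo _] := adm s; have /andP[_ up] := adm u.
have le1 : fine (mu `]u + r, s - r[%classic) <= 2 * y.
  have : Fdist_left mu (s - r) <= Fdist mu (u + r) + 2 * y.
    by move: lo up; rewrite Fus -/r; lra.
  by rewrite (@Fdist_leftD (u + r) (s - r)) ?lerD2l// /s; lra.
apply: le_trans le1; apply: fine_le_measure => //.
by apply: subset_itvl; rewrite bnd_simp /s; lra.
Qed.

Lemma levy_dist_gap n (x p : 'rV[R]_n) y : Pi p ->
  levy_dist eps mu (delta x p) < y ->
  gap_condition eps mu y [seq x ord0 j | j <- enum 'I_n].
Proof.
move=> pP ly.
have hinf : has_inf (levy_admissible mu (delta x p)).
  by split; [exists 1; exact: levy_admissible1|exact: levy_admissible_lbound].
have [y' ay' lt_y'] := @inf_adherent R (levy_admissible mu (delta x p))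
  (y - levy_dist eps mu (delta x p)) ltac:(lra) hinf.
apply: gap_condition_mono (admissible_gap ay').
by move: lt_y'; rewrite -levy_distE; lra.
Qed.

Lemma monotone_cut n (X : nat -> R) t : {homo X : i j / (i <= j)%N >-> i <= j} ->
  exists2 i, (i <= n)%N & forall j, (j < n)%N -> (X j <= t) = (j < i)%N.
Proof.
move=> ndX; elim: n => [|n [i ilen Hi]]; first by exists 0%N.
have [iltn|nlei] := ltnP i n.
  exists i => [|j]; first exact: ltnW.
  rewrite ltnS leq_eqVlt => /predU1P[->|/Hi//].
  rewrite [RHS]ltnNge (ltnW iltn) /=; apply/negbTE; rewrite -ltNge.
  by apply: (lt_le_trans _ (ndX i n (ltnW iltn))); rewrite ltNge Hi// ltnn.
have ein : i = n by apply/eqP; rewrite eqn_leq ilen.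
rewrite {}ein in Hi.
have [Xn|tX] := leP (X n) t.
  exists n.+1 => // j jn; rewrite jn; apply: le_trans Xn; exact: ndX.
exists n => // j; rewrite ltnS leq_eqVlt => /predU1P[->|/Hi//].
by rewrite ltnn; apply/negbTE; rewrite -ltNge.
Qed.

(** Converse of [admissible_gap]: as value between the atoms [X j] and
    [X j.+1] one takes the largest one allowed at [X j], capped by 1; the gap
    condition says that it is large enough at [X j.+1]. *)
Lemma levy_dist_le_of_gaps n (X : nat -> R) y : (0 < n)%N -> 0 < y ->
  {homo X : i j / (i <= j)%N >-> i <= j} ->
  fine (mu `]-oo, X 0%N - y / eps[%classic) <= y ->
  fine (mu `]X n.-1 + y / eps, +oo[%classic) <= y ->
  (forall j, (j.+1 < n)%N ->
    fine (mu `]X j + y / eps, X j.+1 - y / eps[%classic) <= 2 * y) ->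
  exists2 p : 'rV[R]_n, Pi p & levy_dist eps mu (delta (\row_j X j) p) <= y.
Proof.
move=> n0 y0 ndX left right gap; move: left right gap.
set r := y / eps => left right gap.
have r0 : 0 < r by rewrite divr_gt0.
(* The value of the distribution function after the first [i] atoms. *)
pose c i := if i is i'.+1 then Num.min 1 (Fdist mu (X i' + r) + y) else 0.
have c_nd i : c i <= c i.+1.
  case: i => [|i] /=; first by rewrite le_min ler01 addr_ge0 ?Fdist_ge0// ltW.
  apply: le_min2 => //; rewrite lerD2r; apply: Fdist_le; rewrite lerD2r.
  exact: ndX.
have cn : c n = 1.
  case: n n0 right {gap} => // n _ /= right; apply/min_idPl.
  by have := FdistC (X n + r); lra.
pose p : 'rV[R]_n := \row_(j < n) (c j.+1 - c j).
have pE t i : (i <= n)%N -> (forall j, (j < n)%N -> (X j <= t) = (j < i)%N) ->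
    Fdist (delta (\row_j X j) p) t = c i.
  move=> ilen Hi; rewrite Fdist_delta.
  transitivity (\sum_(j < n | (j < i)%N) (c j.+1 - c j)).
    rewrite [RHS]big_mkcond; apply: eq_bigr => j _; rewrite !mxE Hi//.
    by case: ifP => _; rewrite ?mulr1 ?mulr0.
  rewrite -(big_ord_widen n (fun j => c j.+1 - c j) ilen).
  by rewrite -(big_mkord xpredT (fun j => c j.+1 - c j)) telescope_sumr// subr0.
exists p.
  split=> [j|]; first by rewrite mxE subr_ge0.
  under eq_bigr do rewrite mxE.
  rewrite -(big_mkord xpredT (fun j => c j.+1 - c j)) telescope_sumr//.
  by rewrite cn subr0.
rewrite levy_distE; apply: ge_inf; first exact: levy_admissible_lbound.
split=> // t; rewrite -/r.
(* The index [i] below is the number of atoms in `]-oo, t]`. *)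
have [i ilen Hi] := @monotone_cut n X t ndX.
rewrite (pE t i ilen Hi); apply/andP; split; last first.
  case: i ilen Hi => [|i] ilen Hi /=; first by rewrite addr_ge0 ?Fdist_ge0// ltW.
  rewrite ge_min; apply/orP; right; rewrite lerD2r; apply: Fdist_le.
  by rewrite lerD2r Hi.
have [iltn|nlei] := ltnP i n; last first.
  have -> : i = n by apply/eqP; rewrite eqn_leq ilen.
  by rewrite cn; have := Fdist_left_le1 (t - r); lra.
have tX : t < X i by rewrite ltNge Hi// ltnn.
have : Fdist_left mu (t - r) <= Fdist_left mu (X i - r).
  by apply: Fdist_left_le; rewrite lerD2r ltW.
case: i ilen Hi iltn tX => [|i] ilen Hi iltn tX Fle /=.
  by move: left; rewrite -/(Fdist_left _ _); lra.
rewrite le_min; apply/andP; split.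
  by have := Fdist_left_le1 (t - r); lra.
suff : Fdist_left mu (X i.+1 - r) <= Fdist mu (X i + r) + 2 * y by lra.
have [le_|lt_] := leP (X i.+1 - r) (X i + r); last first.
  by rewrite (Fdist_leftD lt_) lerD2l; exact: gap.
apply: (@le_trans _ _ (Fdist mu (X i + r))); last lra.
apply: fine_le_measure => //.
by apply: subset_itvl; rewrite bnd_simp.
Qed.

End LevyDistance.

(** * The limit measure in terms of a nonnegative density *)

Section LimitMeasure.
Context {R : realType}.
Notation lebesgue := (@lebesgue_measure R).

(** The Radon-Nikodym derivative of a charge is nonnegative only almost
    everywhere; it is replaced by a version that is so everywhere.  The factor
    [2 eps] between [phi] and [Omega] cancels in the quotient. *)
Lemma density_mu_star (mu : probability (measurableTypeR R) R)
    (muA muS : {finite_measure set (measurableTypeR R) -> \bar R}) (eps : R) :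
  0 < eps -> lebesgue_decomposition mu muA muS ->
  exists2 f : R -> R, has_density mu muA muS f &
    forall A : set (measurableTypeR R), measurable A -> mu_star eps muA A =
      (\int[lebesgue]_(t in A) phi eps (f t) / \int[lebesgue]_t phi eps (f t))%:E.
Proof.
move=> eps0 [hAS dom sing].
pose F := Radon_Nikodym_SigmaFinite.f muA lebesgue.
have Ffin t : F t \is a fin_num by exact: Radon_Nikodym_SigmaFinite.f_fin_num.
have FE : EFin \o (fine \o F) = F.
  by apply/funext => t /=; rewrite fineK.
have Fint : lebesgue.-integrable setT F.
  exact: Radon_Nikodym_SigmaFinite.f_integrable.
have hd : has_density mu muA muS (fine \o F).
  split=> //.
  - by apply/measurable_EFinP; rewrite FE; exact: measurable_int Fint.
  - by move=> t /=; rewrite fine_ge0// Radon_Nikodym_SigmaFinite.f_ge0.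
  - by rewrite FE.
  - move=> A mA; rewrite (Radon_Nikodym_SigmaFinite.f_integral dom mA).
    by apply: eq_integral => t _; rewrite /= fineK.
exists (fine \o F) => // A mA.
pose g t := fine ((Radon_Nikodym (charge_of_finite_measure muA) lebesgue) t).
have gF : ae_eq lebesgue setT F (EFin \o g).
  have := ae_eq_Radon_Nikodym_SigmaFinite dom measurableT.
  apply: filterS => t FG _; rewrite /F FG//= /g fineK//.
  exact: Radon_Nikodym_fin_num.
have mg : measurable_fun setT g.
  apply/measurable_EFinP.
  apply: (eq_measurable_fun (Radon_Nikodym (charge_of_finite_measure muA) lebesgue)).
    by move=> t _; rewrite /= /g fineK//; exact: Radon_Nikodym_fin_num.
  exact: measurable_int (Radon_Nikodym_integrable _).
have phii := phi_integrable eps0 hd.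
have mphi : measurable_fun setT (phi eps \o g).
  exact: measurableT_comp (measurable_phi eps) mg.
pose c := \int[lebesgue]_s Omega (eps^-1 * g s).
have scaled (r : R) (B : set (measurableTypeR R)) : measurable B ->
    (\int[lebesgue]_(t in B) (r * phi eps (g t))%:E)%E =
    (r * \int[lebesgue]_(t in B) phi eps ((fine \o F) t))%:E.
  move=> mB; have phiB := integrableS measurableT mB (@subsetT _ B) phii.
  rewrite -RintegralZl// /Rintegral fineK; last first.
    apply: integrable_fin_num => //.
    apply: (eq_integrable _ (fun t => r%:E * (phi eps ((fine \o F) t))%:E)%E) => //.
    exact: integrableZl.
  apply: ae_eq_integral => //.
  - apply/measurable_EFinP/measurable_funTS; apply: measurable_funM => //.
  - apply/measurable_EFinP; apply: measurable_funM => //.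
    by apply/measurable_EFinP; exact: measurable_int phiB.
  - apply: filterS gF => t FG _ /=; congr (r * phi eps _)%:E.
    by rewrite FG.
have e2 : 2 * eps != 0 by rewrite lt0r_neq0// mulr_gt0.
have OmegaE s : Omega (eps^-1 * s) = (2 * eps)^-1 * phi eps s.
  by rewrite /phi mulKf.
have cE : c = (2 * eps)^-1 * \int[lebesgue]_t phi eps ((fine \o F) t).
  rewrite /c /Rintegral; under eq_integral do rewrite OmegaE.
  by rewrite scaled.
rewrite /mu_star /star_density -/(g _).
transitivity (\int[lebesgue]_(t in A) ((2 * eps * c)^-1 * phi eps (g t))%:E)%E.
  apply: eq_integral => t _; rewrite -/(g t) -/c OmegaE; congr EFin.
  by rewrite (invfM (2 * eps) c) mulrAC.
rewrite scaled// cE mulVKf// mulrC //.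
Qed.

End LimitMeasure.

(** * Asymptotics of the distance and of the point counts *)

Section Asymptotics.
Context {R : realType}.
Notation lebesgue := (@lebesgue_measure R).
Variables (mu : probability (measurableTypeR R) R)
  (muA muS : {finite_measure set (measurableTypeR R) -> \bar R})
  (eps : R) (f : R -> R).
Hypothesis eps_gt0 : 0 < eps.
Hypothesis hd : has_density mu muA muS f.
Hypothesis sing : mutually_singular muS lebesgue.

Notation K A := (\int[lebesgue]_(t in A) phi eps (f t)).
Notation Phi := (\int[lebesgue]_t phi eps (f t)).

Lemma phi_integral_ge0 (A : set R) : 0 <= K A.
Proof.
by case: hd => _ f0 _ _ _; apply: Rintegral_ge0 => t _; exact: phi_ge0. Qed.

Lemma phi_integral_setU (A B : set (measurableTypeR R)) :
  measurable A -> measurable B -> A `&` B = set0 -> K (A `|` B) = K A + K B.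
Proof.
move=> mA mB AB; rewrite Rintegral_setU//.
- apply: integrableS (phi_integrable eps_gt0 hd) => //; exact: measurableU.
- by apply/disj_setPS; rewrite AB.
Qed.

Lemma phi_integral_le_massA (A : set (measurableTypeR R)) :
  measurable A -> K A <= fine (muA A).
Proof.
move=> mA; case: (hd) => _ f0 fi _ hA; rewrite hA//.
apply: le_Rintegral => //.
- exact: integrableS (phi_integrable eps_gt0 hd).
- exact: integrableS fi.
- by move=> t _; exact: phi_le.
Qed.

(** An arbitrary interval differs from the interior of its bounded truncation
    by a null set and by two tails of small mass. *)
Lemma points_needed_interval (J : set R) (slack : R) :
  is_interval J -> 0 < slack ->
  exists m : nat, forall (y : R) X, 0 < y -> gap_condition eps mu y X ->
    K J <= 2 * y * (count (fun x => x \in J) X + m)%:R + slack.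
Proof.
move=> itvJ slack0; have d30 : 0 < slack / 3 by lra.
have mJ := is_interval_measurable itvJ.
have [s1 hs1] := left_tail muA d30; have [s2 hs2] := right_tail muA d30.
pose J' := J `&` `]s1, s2]%classic.
have mJ' : measurable (J' : set (measurableTypeR R)) by exact: measurableI.
have KJ : K J <= K J' + slack / 3 + slack / 3.
  have JU : J `<=` (`]-oo, s1] `|` `]s2, +oo[) `|` J'.
    move=> t Jt; have [ts1|s1t] := leP t s1; first by left; left; rewrite /= in_itv.
    have [ts2|s2t] := leP t s2; last by left; right; rewrite /= in_itv/= s2t.
    by right; split=> //; rewrite /= in_itv/= s1t.
  have m1 : measurable (`]-oo, s1]%classic : set (measurableTypeR R)) by [].
  have m2 : measurable (`]s2, +oo[%classic : set (measurableTypeR R)) by [].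
  have split_le (A B : set (measurableTypeR R)) : measurable A -> measurable B ->
      K (A `|` B) <= K A + K B.
    move=> mA mB; rewrite (_ : A `|` B = A `|` (B `\` A)); last first.
      by rewrite setUDr setDv setD0.
    rewrite phi_integral_setU//; [|exact: measurableD|]; last first.
      by rewrite setIDA setIC -setIDA setDv setI0.
    rewrite lerD2l; apply: (phi_integral_le eps_gt0 hd) => //; exact: measurableD.
  apply: (le_trans (phi_integral_le eps_gt0 hd _ _ JU)) => //.
    by apply: measurableU => //; exact: measurableU.
  apply: (le_trans (split_le _ _ _ _)) => //; first exact: measurableU.
  have := split_le _ _ m1 m2; have := phi_integral_le_massA m1.
  have := phi_integral_le_massA m2.
  lra.
have [J'0|/set0P[z J'z]] := eqVneq J' set0.
  exists 0%N => y X y0 gap; move: KJ; rewrite J'0 Rintegral_set0.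
  have : 0 <= 2 * y * (count (fun x => x \in J) X + 0)%:R.
    by rewrite mulr_ge0// mulr_ge0// ltW.
  lra.
have J's t : J' t -> s1 < t <= s2 by move=> [_] /=; rewrite in_itv.
have hinf : has_inf J' by split; [exists z | exists s1 => t /J's /andP[/ltW]].
have hsup : has_sup J' by split; [exists z | exists s2 => t /J's /andP[]].
have J'ab t : J' t -> inf J' <= t <= sup J'.
  by move=> J't; rewrite ge_inf ?ub_le_sup//; [case: hsup|case: hinf].
have abJ t : inf J' < t < sup J' -> J t.
  move=> /andP[it ts].
  have [u [Ju _] ut] := @inf_adherent _ J' (t - inf J') ltac:(lra) hinf.
  have [v [Jv _] tv] := @sup_adherent _ J' (sup J' - t) ltac:(lra) hsup.
  by apply: (itvJ u v) => //; apply/andP; split; lra.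
have KJ' : K J' <= integral_oc (phi eps \o f) (inf J') (sup J').
  rewrite /integral_oc Rintegral_itv_obnd_cbnd.
    apply: (phi_integral_le eps_gt0 hd) => // t /J'ab; by rewrite /= in_itv.
  exact: integrableS (phi_integrable eps_gt0 hd).
have [ab|ba] := ltP (inf J') (sup J'); last first.
  have : integral_oc (phi eps \o f) (inf J') (sup J') = 0.
    by rewrite /integral_oc set_itv_ge ?Rintegral_set0// bnd_simp -leNgt.
  exists 0%N => y X y0 gap.
  have : 0 <= 2 * y * (count (fun x => x \in J) X + 0)%:R.
    by rewrite mulr_ge0// mulr_ge0// ltW.
  lra.
have [m Hm] := points_needed eps_gt0 hd ab d30.
exists m => y X y0 gap; have := Hm y X y0 gap.
have : 2 * y * (count (fun x => inf J' < x < sup J') X + m)%:R <=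
       2 * y * (count (fun x => x \in J) X + m)%:R.
  apply: ler_wpM2l; first lra.
  rewrite ler_nat leq_add2r; apply: sub_count => t /abJ Jt; exact/mem_set.
lra.
Qed.

(** The [k] greedy steps give [k + 1] atoms, at the centres of the blind zones;
    one more atom far to the right, repeated as often as needed, makes their
    number exactly [n] and reduces the right tail. *)
Lemma good_configuration (slack : R) : 0 < slack -> exists l : nat,
  forall (y : R) (n : nat), 0 < y -> Phi + slack + 2 * y * l%:R <= 2 * y * n%:R ->
    exists x p : 'rV[R]_n,
      [/\ Xi x, Pi p & levy_dist eps mu (delta x p) <= y].
Proof.
move=> slack0.
have [_ [l Hl]] := few_steps_total eps_gt0 hd sing slack0.
exists l.+2 => y n y0 hn.
have [s0 hs0] := left_tail mu y0; have [s1 hs1] := right_tail mu y0.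
set r := y / eps.
have rE : 2 * y / eps = r + r by rewrite /r; field; rewrite lt0r_neq0.
have r0 : 0 < r by rewrite divr_gt0.
(* The left tail up to [s0] has mass at most [y]; the first atom is [s0 + r]
   and its blind zone ends at [s0 + r + r]. *)
have [t [k [t0 tstep tgap tail]]] := greedy_steps mu eps_gt0 (s0 + r + r) y0.
have tnd i j : (i <= j)%N -> (j <= k)%N -> t i <= t j.
  exact: (steps_le eps_gt0 y0 tstep).
have kn : (k.+2 <= n)%N.
  have y20 : 0 < 2 * y by lra.
  rewrite -(ler_nat R) -(ler_pM2l y20).
  have := Hl y t k y0 tstep I I; move: hn.
  rewrite -[k.+2]addn2 -[l.+2]addn2 !natrD !mulrDr; lra.
pose z := Num.max (t k) s1.
pose X j := if (j <= k)%N then t j - r else z + r.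
have tz : t k <= z by rewrite le_max lexx.
have X_nd : {homo X : i j / (i <= j)%N >-> i <= j}.
  move=> i j ij; rewrite /X; have [jk|kj] := leqP j k.
    by rewrite (leq_trans ij jk) lerD2r; exact: tnd.
  have [ik|ki] := leqP i k => //.
  by have := tnd i k ik (leqnn k); lra.
have [||||p pP le_y] := @levy_dist_le_of_gaps R mu eps eps_gt0 n X y _ y0 X_nd.
- by apply: leq_trans kn.
- rewrite /X leq0n t0 -/r.
  apply: le_trans hs0; apply: fine_le_measure => //.
  by apply: subset_itvl; rewrite bnd_simp; lra.
- have -> : X n.-1 = z + r by rewrite /X leqNgt -ltnS (ltn_predK kn) kn.
  apply: le_trans hs1; apply: fine_le_measure => //.
  have : s1 <= z by rewrite le_max lexx orbT.
  by move=> s1z; apply: subset_itvr; rewrite bnd_simp -/r; lra.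
- move=> j jn; rewrite -/r /X.
  have [jk|kj] := ltnP j k.
    rewrite (ltnW jk) -addrA addNr addr0 -addrA -opprD -rE; exact: tgap.
  have [jk|{}kj] := leqP j k.
    have -> : j = k by apply/eqP; rewrite eqn_leq jk.
    rewrite -addrA addNr addr0; apply: le_trans tail.
    apply: fine_le_measure => //.
    by apply: subset_itvl; rewrite bnd_simp.
  rewrite set_itv_ge ?measure0 /= ?mulr_ge0 ?(ltW y0)// bnd_simp -leNgt; lra.
exists (\row_j X j), p; split => // i j ij; rewrite !mxE; exact: X_nd.
Qed.

(** The best distance with [n] atoms is at most [(Phi + o(1)) / 2n], and an
    asymptotically minimal sequence loses only a factor tending to 1. *)
Lemma levy_dist_upper (x : forall n : nat, 'rV[R]_n) (rho : R) :
  asymptotically_minimal eps mu x -> 0 < rho ->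
  \forall n \near \oo, exists p : 'rV[R]_n,
    Pi p /\ levy_dist eps mu (delta (x n) p) < (Phi + rho) / (2 * n%:R).
Proof.
move=> [p [y [q [hp hy ratio]]]] rho0.
have Phi0 : 0 <= Phi by exact: phi_integral_ge0.
have rho20 : 0 < rho / 2 by lra.
have [l Hl] := good_configuration rho20.
move: Phi0 Hl; move: Phi => P P0 Hl.
(* [w] leaves room on both sides: above [P + rho / 2] for a constant number of
   additional atoms, below [P + rho] for the ratio of the two distances. *)
pose w := P + 3 * rho / 4.
have w0 : 0 < w by rewrite /w; lra.
pose kappa := (P + rho) / w.
have kappa1 : 1 < kappa by rewrite ltr_pdivlMr// mul1r /w; lra.
have eta0 : 0 < kappa - 1 by lra.
move/cvgrPdist_lt : ratio => ratio_near.
near=> n.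
have n0 : (0 < n)%N by near: n; exact: nbhs_infty_gt.
have nR : 0 < n%:R :> R by rewrite ltr0n.
exists (p n); split; first by case: (hp n n0).
set d := levy_dist _ _ _.
pose b := levy_dist eps mu (delta (y n) (q n)).
have r1 : `|1 - d / b| < kappa - 1.
  by rewrite /d /b; near: n; exact: ratio_near.
have r2 : `|1 - d / b| < 1.
  by rewrite /d /b; near: n; exact/ratio_near/ltr01.
have b0 : 0 < b.
  rewrite lt_neqAle levy_dist_ge0 andbT; apply/eqP => b0.
  by move: r2; rewrite -b0 invr0 mulr0 subr0 normr1 ltxx.
have db : d < kappa * b.
  rewrite -ltr_pdivrMr//; move: r1; rewrite ltr_norml => /andP[+ _]; lra.
have yn0 : 0 < w / (2 * n%:R) by rewrite divr_gt0// mulr_gt0.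
have [|x' [p' [x'P p'P le_w]]] := Hl (w / (2 * n%:R)) n yn0.
  have nE : 2 * (w / (2 * n%:R)) * n%:R = w by field; rewrite lt0r_neq0.
  have lE : 2 * (w / (2 * n%:R)) * l%:R = w * l%:R / n%:R.
    by field; rewrite lt0r_neq0.
  rewrite nE lE.
  suff : w * l%:R / n%:R <= rho / 4 by rewrite /w; lra.
  rewrite ler_pdivrMr// -ler_pdivrMl; last by lra.
  by near: n; exact: nbhs_infty_ger.
have bw : b <= w / (2 * n%:R).
  by apply: le_trans le_w; case: (hy n n0) => _ _; exact.
apply: (lt_le_trans db).
have -> : (P + rho) / (2 * n%:R) = kappa * (w / (2 * n%:R)).
  by rewrite /kappa mulrA divfK// lt0r_neq0.
by rewrite ler_pM2l//; lra.
Unshelve. all: by end_near. Qed.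

(** The lower bound on the number of atoms in [J], evaluated at a level [y] with
    [2 n y] close to [Phi], which [levy_dist_upper] provides. *)
Lemma count_ratio_lower (x : forall n : nat, 'rV[R]_n) (J : set R) (rho : R) :
  asymptotically_minimal eps mu x -> 0 < Phi -> is_interval J -> 0 < rho ->
  \forall n \near \oo,
    K J / Phi - rho <= #|[pred j : 'I_n | x n ord0 j \in J]|%:R / n%:R.
Proof.
move=> xmin Phi0 itvJ rho0.
(* A multiple of [Phi], because the error is eventually divided by [Phi]. *)
pose slack := rho * Phi / 4.
have slack0 : 0 < slack by rewrite divr_gt0// mulr_gt0.
have [m Hm] := points_needed_interval itvJ slack0.
near=> n.
have n0 : (0 < n)%N by near: n; exact: nbhs_infty_gt.
have nR : 0 < n%:R :> R by rewrite ltr0n.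
have [p [pP ly]] : exists p : 'rV[R]_n,
    Pi p /\ levy_dist eps mu (delta (x n) p) < (Phi + slack) / (2 * n%:R).
  by near: n; exact: levy_dist_upper.
have gap := levy_dist_gap eps_gt0 pP ly.
have y0 : 0 < (Phi + slack) / (2 * n%:R) by rewrite divr_gt0 ?addr_gt0 ?mulr_gt0.
have := Hm _ _ y0 gap.
have -> : count (fun z => z \in J) [seq x n ord0 j | j <- enum 'I_n] =
    #|[pred j : 'I_n | x n ord0 j \in J]|.
  rewrite count_map -sum1_count -sum1_card big_enum_cond.
  by apply: eq_bigl => j; rewrite !inE.
set N := #|_|.
have -> : 2 * ((Phi + slack) / (2 * n%:R)) * (N + m)%:R =
    (Phi + slack) * (N%:R / n%:R + m%:R / n%:R).
  by rewrite natrD; field; rewrite lt0r_neq0.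
have mn : m%:R / n%:R <= rho / 2.
  rewrite ler_pdivrMr// -ler_pdivrMl; last by lra.
  by near: n; exact: nbhs_infty_ger.
have KP : K J <= Phi.
  by apply: (phi_integral_le eps_gt0 hd) => //; exact: is_interval_measurable.
have KE : K J = Phi * (K J / Phi) by rewrite mulrC divfK// lt0r_neq0.
have K1 : K J / Phi <= 1 by rewrite ler_pdivrMr// mul1r.
move: KE K1 mn {KP Hm}; rewrite /slack.
move: (K J / Phi) (N%:R / n%:R) (m%:R / n%:R) => a b c KE a1 mn.
rewrite {}KE => hle.
have hle2 : a <= (1 + rho / 4) * (b + c) + rho / 4.
  rewrite -(ler_pM2l Phi0); move: hle; set P := Phi; lra.
rewrite leNgt; apply/negP => ba.
have h1 : 0 < (1 + rho / 4) * (a - rho / 2 - (b + c)) by rewrite mulr_gt0//; lra.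
have h2 : 0 <= rho * (1 - a) by rewrite mulr_ge0//; lra.
have h3 : 0 < rho * rho by rewrite mulr_gt0.
by clear -hle2 h1 h2 h3; nra.
Unshelve. all: by end_near. Qed.
End Asymptotics.

(** * Convergence on intervals *)

Section Conclusion.
Context {R : realType}.
Notation lebesgue := (@lebesgue_measure R).

Lemma phi_integral_gt0 (mu : probability (measurableTypeR R) R)
    (muA muS : {finite_measure set (measurableTypeR R) -> \bar R})
    (eps : R) (f : R -> R) : 0 < eps -> has_density mu muA muS f ->
  (exists2 A : set (measurableTypeR R), measurable A & muA A <> 0%E) ->
  0 < \int[lebesgue]_t phi eps (f t).
Proof.
move=> eps0 hd [A mA muA0]; case: (hd) => mf f0 _ _ hA.
have phii := phi_integrable eps0 hd.
have Phi_ge0 : 0 <= \int[lebesgue]_t phi eps (f t).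
  by apply: Rintegral_ge0 => t _; exact: phi_ge0.
rewrite lt_neqAle Phi_ge0 andbT; apply/eqP => Phi0; apply: muA0.
have mphi : measurable_fun setT (EFin \o (phi eps \o f)).
  exact: measurable_int phii.
have phi_ae0 : ae_eq lebesgue setT (EFin \o (phi eps \o f)) (cst 0%E).
  apply/(ae_eq_integral_abs lebesgue measurableT mphi).
  transitivity (\int[lebesgue]_(t in setT) (EFin \o (phi eps \o f)) t)%E.
    by apply: eq_integral => t _; rewrite /= ger0_norm// phi_ge0.
  rewrite -[LHS]fineK ?integrable_fin_num//.
  by congr EFin; exact/esym.
rewrite hA//.
transitivity (\int[lebesgue]_(t in A) cst 0%E t)%E; last exact: integral0.
apply: ae_eq_integral => //.
- by apply/measurable_EFinP; exact: measurable_funTS.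
- apply: filterS phi_ae0 => t /(_ I) /= [] + _; rewrite phiE// => ft0.
  congr EFin; have e1 : eps + f t != 0 by rewrite lt0r_neq0// ltr_pwDl.
  move/eqP : ft0; rewrite mulf_eq0 invr_eq0 (negbTE e1) orbF mulf_eq0.
  by rewrite (gt_eqF eps0) => /eqP.
Qed.

Lemma card_split3 n (A B C : set R) (x : 'I_n -> R) :
  (forall t, (t \in A) + (t \in B) + (t \in C) = 1)%N ->
  (#|[pred j | x j \in A]| + #|[pred j | x j \in B]| +
     #|[pred j | x j \in C]|)%N = n.
Proof.
move=> ABC.
have cardE D : #|[pred j | x j \in D]| = (\sum_(j < n) (x j \in D))%N.
  rewrite -sum1_card big_mkcond; apply: eq_bigr => j _.
  by rewrite !inE; case: (_ \in _).
rewrite !cardE -!big_split /= -[RHS]card_ord -sum1_card.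
by apply: eq_bigr => j _; exact: ABC.
Qed.

(** The two parts of the complement of an interval, defined through the
    downward closure of [I] so that the empty interval is no exception. *)
Lemma interval_split (I : set R) : is_interval I -> exists B C : set R,
  [/\ is_interval B, is_interval C, I `&` B = set0, (I `|` B) `&` C = set0 &
      I `|` B `|` C = setT].
Proof.
move=> itvI; pose L := [set t | exists2 s, I s & t <= s].
exists (L `\` I), (~` L); split.
- move=> u v [Lu NIu] [[s Is vs] NIv] t /andP[ut tv]; split.
    by exists s => //; exact: le_trans vs.
  move=> It; apply: NIv; apply: (itvI t s) => //; exact/andP.
- move=> u v NLu _ t /andP[ut _] [s Is ts]; apply: NLu; exists s => //.
  exact: le_trans ts.
- by apply/seteqP; split=> // t [It [_]].
- by apply/seteqP; split=> // t [[It|[]//] NL]; apply: NL; exists t.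
- apply/seteqP; split=> // t _; have [It|NIt] := pselect (I t); first by left; left.
  by have [Lt|NLt] := pselect (L t); [left; right|right].
Qed.

End Conclusion.

Theorem theorem4p6 (R : realType) (mu : probability (measurableTypeR R) R)
    (muA muS : {finite_measure set (measurableTypeR R) -> \bar R})
    (eps : R) (x : forall n : nat, 'rV[R]_n)
    (heps : 0 < eps)
    (hdec : lebesgue_decomposition mu muA muS)
    (hA : exists2 A : set (measurableTypeR R), measurable A & muA A <> 0%E)
    (hx : forall n : nat, (0 < n)%N -> Xi (x n))
    (hmin : asymptotically_minimal eps mu x)
    (I : set R) (hI : is_interval I) :
  ((#|[pred j : 'I_n | x n ord0 j \in I]|%:R / n%:R : R)%:E
     @[n --> \oo] --> mu_star eps muA I)%E.
Proof.
have [f hd starE] := density_mu_star heps hdec.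
have sing : mutually_singular muS lebesgue_measure by case: hdec.
have Phi0 := phi_integral_gt0 heps hd hA.
rewrite starE; last exact: is_interval_measurable.
have [B [C [itvB itvC IB IBC full]]] := interval_split hI.
have [mI mB mC] : [/\ measurable (I : set (measurableTypeR R)),
    measurable (B : set (measurableTypeR R)) &
    measurable (C : set (measurableTypeR R))].
  by split; exact: is_interval_measurable.
have Ksum := phi_integral_setU heps hd (measurableU _ _ mI mB) mC IBC.
rewrite full (phi_integral_setU heps hd mI mB IB) in Ksum.
have one t : ((t \in I) + (t \in B) + (t \in C) = 1)%N.
  have tU : (I `|` B `|` C) t by rewrite full.
  have NIB : ~ (I `&` B) t by rewrite IB.
  have NIBC : ~ ((I `|` B) `&` C) t by rewrite IBC.
  case: tU => [[It|Bt]|Ct].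
  - rewrite (mem_set It) memNset ?memNset//.
      by move=> Ct; apply: NIBC; split=> //; left.
    by move=> Bt; apply: NIB.
  - rewrite (mem_set Bt) memNset ?memNset//.
      by move=> Ct; apply: NIBC; split=> //; right.
    by move=> It; apply: NIB.
  - rewrite (mem_set Ct) memNset ?memNset//.
      by move=> Bt; apply: NIBC; split=> //; right.
    by move=> It; apply: NIBC; split=> //; left.
pose k (J : set R) := \int[lebesgue_measure]_(t in J) phi eps (f t) /
  \int[lebesgue_measure]_t phi eps (f t).
pose N n (J : set R) : R := #|[pred j : 'I_n | x n ord0 j \in J]|%:R / n%:R.
have ksum : k I + k B + k C = 1.
  by rewrite /k -!mulrDl -Ksum divff// lt0r_neq0.
have Nsum n : (0 < n)%N -> N n I + N n B + N n C = 1.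
  move=> n0; rewrite /N -!mulrDl -!natrD.
  by rewrite (card_split3 (fun j => x n ord0 j) one) divff// pnatr_eq0 -lt0n.
apply: cvg_EFin; first by near=> n.
apply/cvgrPdist_le => /= rho rho0.
have r2 : 0 < rho / 2 by rewrite divr_gt0.
have low J itvJ : \forall n \near \oo, k J - rho / 2 <= N n J :=
  @count_ratio_lower _ _ _ _ _ _ heps hd sing x J _ hmin Phi0 itvJ r2.
near=> n; rewrite -/(k I) -/(N n I).
have n0 : (0 < n)%N by near: n; exact: nbhs_infty_gt.
have lowI : k I - rho / 2 <= N n I by near: n; exact: low.
have lowB : k B - rho / 2 <= N n B by near: n; exact: low.
have lowC : k C - rho / 2 <= N n C by near: n; exact: low.
move: lowI lowB lowC (Nsum n n0) ksum.
move: (k I) (k B) (k C) (N n I) (N n B) (N n C) => k1 k2 k3 N1 N2 N3.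
by move=> l1 l2 l3 Ns ks; rewrite ler_norml; apply/andP; split; lra.
Unshelve. all: by end_near. Qed.
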